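(* For every positive integer $n$ and every $\epsilon\in(0,1)$ there is a constant $c_{n,\epsilon}>0$, depending only on $n$ and $\epsilon$, such that the following holds. Let $I\subset\mathbb{R}$ be an open interval (possibly infinite), $K\subset I$ a closed set, and $\mu$ a regular probability measure supported on $K$. Then there exists a closed interval $I'\subset I$ (possibly a single point) with $\mu(I')\ge\frac{1-\epsilon}{n}$ such that, for every $C\ge1$ and every function $f$ which is of polynomial type $n$ on $(K_\epsilon,I)$ with constant $C$, $$\int|f(t)|\,d\mu(t)\;\ge\;c_{n,\epsilon}\,C^{-1}\min\{|I'|^j,|\mu|_{n,\epsilon}^j\}\sup_{t\in I'}|f^{(j)}(t)|$$ for every $j=0,\ldots,n$.
   Context: For a closed set $K$ contained in an open interval $I$ and $\epsilon\in(0,1)$, $K_\epsilon:=K\cup K_R\cup K_L$, where $K_R$ and $K_L$ consist of points $t\in I$ that are bounded on both sides by $K$ (that is, $K$ contains a point $\le t$ and a point $\ge t$) and satisfy respectively $$K_R:\ \inf\{d\ge0: t+d\in K\}\le\epsilon\,\inf\{d\ge0:t-d\in K\},\qquad K_L:\ \inf\{d\ge0: t-d\in K\}\le\epsilon\,\inf\{d\ge0:t+d\in K\}.$$ For a set $S\subset I$ and a nonnegative integer $n$, a function $f\in C^n(I)$ is of polynomial type $n$ on $(S,I)$ with constant $C$ if $f^{(n)}$ does not change sign on $I$ (it is everywhere nonnegative or everywhere nonpositive) and $\sup_{t\in I}|f^{(n)}(t)|\le C\inf_{t\in S}|f^{(n)}(t)|$ with $C$ finite. $|\mu|_{n,\epsilon}$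 denotes the infimum of $\sum_{j=1}^n|I_j|$ over all collections of closed intervals $\{I_1,\ldots,I_n\}$ (possibly single points) with $\mu(\bigcup_{j=1}^nI_j)\ge1-\epsilon$. $|I'|$ is the length of $I'$; $x^0=1$ for all $x\ge 0$, including $x=0$. *)

(* Defs.v *)
From HB Require Import structures.
From mathcomp Require Export all_boot all_order all_algebra.
From mathcomp Require Export all_classical all_reals all_analysis.
Export Order.TTheory GRing.Theory Num.Theory.
Export numFieldNormedType.Exports.

Set Implicit Arguments.
Unset Strict Implicit.
Unset Printing Implicit Defensive.

Local Open Scope classical_set_scope.
Local Open Scope ring_scope.

(* One-sided distances from [t] to [K].  They are only used at points having
   points of [K] on both sides, so both infima are over nonempty sets of
   nonnegative reals and the real-valued [inf] is the true infimum. *)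
Definition dist_right {R : realType} (K : set R) (t : R) : R :=
  inf [set d | 0 <= d /\ K (t + d)].

Definition dist_left {R : realType} (K : set R) (t : R) : R :=
  inf [set d | 0 <= d /\ K (t - d)].

Definition bounded_both_sides {R : realType} (K : set R) (t : R) : Prop :=
  (exists2 x, K x & x <= t) /\ (exists2 y, K y & t <= y).

Definition K_right {R : realType} (I K : set R) (eps : R) : set R :=
  [set t | [/\ I t, bounded_both_sides K t
             & dist_right K t <= eps * dist_left K t]].

Definition K_left {R : realType} (I K : set R) (eps : R) : set R :=
  [set t | [/\ I t, bounded_both_sides K t
             & dist_left K t <= eps * dist_right K t]].

Definition K_eps {R : realType} (I K : set R) (eps : R) : set R :=
  K `|` K_right I K eps `|` K_left I K eps.

(* [f] is of class C^n on the open set [I]; [f] is a total function, but since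
   [I] is open, its derivatives at points of [I] depend only on the restriction
   of [f] to [I].  Continuity of the lower-order derivatives follows from their
   derivability. *)
Definition Cn_on {R : realType} (n : nat) (I : set R) (f : R -> R) : Prop :=
  (forall j : nat, (j < n)%N -> forall t, I t -> derivable (derive1n j f) t 1)
  /\ {within I, continuous derive1n n f}.

(* Supremum and infimum are taken in the extended reals: the inequality forces
   the supremum to be finite as soon as [S] is nonempty. *)
Definition polynomial_type {R : realType} (n : nat) (S I : set R) (C : R)
    (f : R -> R) : Prop :=
  [/\ Cn_on n I f,
      (forall t, I t -> 0 <= derive1n n f t) \/ (forall t, I t -> derive1n n f t <= 0)
    & (ereal_sup [set (`|derive1n n f t|)%:E | t in I]
       <= C%:E * ereal_inf [set (`|derive1n n f t|)%:E | t in S])%E].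

(* |mu|_{n,eps}: the infimum of total lengths of [n] compact intervals
   (degenerate ones allowed) that together carry mass at least [1 - eps]. *)
Definition measure_length {R : realType} (mu : probability (measurableTypeR R) R)
    (n : nat) (eps : R) : \bar R :=
  ereal_inf [set l : \bar R | exists a b : 'I_n -> R,
    [/\ forall j, a j <= b j,
        ((1 - eps)%:E <= mu (\bigcup_(j in [set: 'I_n]) `[a j, b j]%classic))%E
      & l = (\sum_(j < n) (b j - a j))%:E]].

Definition regular_measure {R : realType}
    (mu : probability (measurableTypeR R) R) : Prop :=
  forall A : set (measurableTypeR R), measurable A ->
    mu A = ereal_inf [set mu U | U in [set U : set R | open U /\ A `<=` U]]
    /\ mu A = ereal_sup [set mu F | F in [set F : set R | compact F /\ F `<=` A]].

(* Main.v *)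
(** Cut [mu] by quantiles [z_0 <= z_1 <= ...] into slots of equal mass, [r] slots
    carrying mass at least [(1 - eps) / n]. For a window [J] of [r] slots let
    [L_p(J)] be the least length of a window of at least [p r] slots containing
    [J], and let [I'] be the window minimising [L_1(J) * ... * L_n(J)]. Every slot
    contains a point [y] of [K] at which [|f y|] is bounded by a multiple of
    [int |f| dmu], so [n+1] such points [x_0, ..., x_n] can be picked with [r]
    slots between any two of them. By minimality of [I'] and a suitable choice of
    the slots, the divided difference of [f] at [x_0, ..., x_k] is at most a
    multiple of [int |f| dmu / (L_1(I') * ... * L_k(I'))], while
    [|t - x_k| <= L_(k+1)(I')] on [I']. The Newton form of the interpolation
    polynomial then bounds [f] on [I'] up to a multiple of
    [sup |f^(n)| * L_1(I') * ... * L_n(I')]. This last term is also under control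
    because the [n]-th divided difference dominates [inf |f^(n)|] over [K_eps]:
    [K_eps] fills a fixed proportion of each gap of [K], near both of its ends.
    Interpolation inequalities for derivatives give the orders [0 < j < n]. *)

From HB Require Import structures.
Require Import Defs.
From mathcomp Require Import measurable_realfun.
From mathcomp Require Import zify ring lra.

Set Implicit Arguments.
Unset Strict Implicit.
Unset Printing Implicit Defensive.

Local Open Scope classical_set_scope.
Local Open Scope ring_scope.

(** * Interpolation polynomials and divided differences *)

Section interpolation.
Variables (R : fieldType) (x : nat -> R).

Definition node_prod (k i : nat) : R := \prod_(l < k | l != i :> nat) (x i - x l).

Definition node_poly (k : nat) : {poly R} := \prod_(l < k) ('X - (x l)%:P).

(** The classical [f[x_0, ..., x_k]] in its explicit symmetric form; it involves one node more than
    [interp f k] and [node_poly k]. *)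
Definition divdiff (f : R -> R) (k : nat) : R :=
  \sum_(i < k.+1) f (x i) / node_prod k.+1 i.

Definition interp (f : R -> R) (k : nat) : {poly R} :=
  \sum_(i < k) (f (x i) / node_prod k i) *:
    \prod_(l < k | l != i :> nat) ('X - (x l)%:P).

Variable N : nat.
Hypothesis x_inj : forall i j, (i < N)%N -> (j < N)%N -> x i = x j -> i = j.

Lemma node_prod_neq0 (k i : nat) : (k <= N)%N -> (i < N)%N -> node_prod k i != 0.
Proof.
move=> kN iN; apply/prodf_neq0 => l li; rewrite subr_eq0.
by apply: contra_neq li => /x_inj -> //; apply: leq_trans kN.
Qed.

Lemma interp_node (f : R -> R) (k i : nat) : (k <= N)%N -> (i < k)%N ->
  (interp f k).[x i] = f (x i).
Proof.
move=> kN ik; rewrite horner_sum (bigD1 (Ordinal ik)) //= [X in _ + X]big1 ?addr0.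
  rewrite hornerZ horner_prod.
  under eq_bigr do rewrite hornerXsubC.
  by rewrite divfK // node_prod_neq0 // (leq_trans ik).
move=> j ji; rewrite hornerZ horner_prod (bigD1 (Ordinal ik)) /=; last first.
  by apply: contra_neq ji => ij; apply/val_inj.
by rewrite hornerXsubC subrr mul0r mulr0.
Qed.

Lemma size_prod_except (k i : nat) : (i < k)%N ->
  size (\prod_(l < k | l != i :> nat) ('X - (x l)%:P) : {poly R}) = k.
Proof.
move=> ik; rewrite -big_filter size_prod_XsubC size_filter.
rewrite -sum1_count.
have -> : (\sum_(l < k | l != i :> nat) 1 = k.-1)%N.
  by rewrite -[X in _ = X.-1]card_ord -(cardC1 (Ordinal ik)) -sum1_card; apply: eq_bigl.
by case: k ik.
Qed.

Lemma size_interp (f : R -> R) (k : nat) : (size (interp f k) <= k)%N.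
Proof.
apply: (leq_trans (size_sum _ _ _)); apply/bigmax_leqP => i _.
by apply: (leq_trans (size_scale_leq _ _)); rewrite size_prod_except.
Qed.

Lemma coef_interp (f : R -> R) (k : nat) : (interp f k.+1)`_k = divdiff f k.
Proof.
rewrite coef_sum; apply: eq_bigr => i _; rewrite coefZ.
set p : {poly R} := \prod_(l < _ | _) _.
have /monicP : p \is monic by apply: monic_prod_XsubC.
by rewrite /lead_coef size_prod_except //= => ->; rewrite mulr1.
Qed.

Lemma size_node_poly (k : nat) : size (node_poly k) = k.+1.
Proof. by rewrite /node_poly size_prod_XsubC -sum1_size sum1_card card_ord. Qed.

Lemma coef_node_poly (k : nat) : (node_poly k)`_k = 1.
Proof.
have /monicP : node_poly k \is monic by apply: monic_prod_XsubC.
by rewrite /lead_coef size_node_poly.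
Qed.

Lemma node_poly_node (k i : nat) : (i < k)%N -> (node_poly k).[x i] = 0.
Proof.
move=> ik; rewrite horner_prod (bigD1 (Ordinal ik)) //= hornerXsubC subrr.
by rewrite mul0r.
Qed.

(** Both sides have the same coefficient in degree [k], so their difference has degree below [k]; it
    also vanishes at the first [k] nodes, hence it is zero. *)
Lemma interp_newton (f : R -> R) (k : nat) : (k < N)%N ->
  interp f k.+1 = interp f k + divdiff f k *: node_poly k.
Proof.
move=> kN; apply/eqP; rewrite -subr_eq0.
set p : {poly R} := _ - _.
have sp : (size p <= k)%N.
  apply/leq_sizeP => j; rewrite leq_eqVlt => /predU1P[<-|kj].
    rewrite !coefD coefN coefD coef_interp coefZ coef_node_poly mulr1.
    by rewrite [(interp f k)`_k]nth_default ?size_interp // add0r subrr.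
  rewrite !coefD coefN coefD coefZ !nth_default ?mulr0 ?addr0 ?subrr //.
  - by rewrite size_node_poly.
  - by apply: leq_trans (size_interp _ _) (ltnW kj).
  - by apply: leq_trans (size_interp _ _) kj.
apply/eqP/(@roots_geq_poly_eq0 _ p (mkseq x k)); last by rewrite size_mkseq.
  apply/allP => _ /mapP[i + ->]; rewrite mem_iota => /andP[_ ik].
  rewrite rootE /p hornerD hornerN hornerD hornerZ node_poly_node // mulr0 addr0.
  by rewrite !interp_node ?subrr // ltnW.
rewrite map_inj_in_uniq ?iota_uniq // => i j.
by rewrite !mem_iota => /andP[_ ik] /andP[_ jk]; apply: x_inj; apply: ltn_trans kN.
Qed.

Lemma interp_newton_sum (f : R -> R) (k : nat) : (k <= N)%N ->
  interp f k = \sum_(i < k) divdiff f i *: node_poly i.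
Proof.
elim: k => [|k IH] kN; first by rewrite /interp !big_ord0.
by rewrite big_ord_recr /= -IH ?interp_newton // ltnW.
Qed.

End interpolation.

(** * Rolle's theorem along a chain of derivatives *)

Section iterated_Rolle.
Variable R : realType.
Implicit Types (D : set R) (h g : nat -> R -> R).

(** Derivatives are carried as a sequence of functions, so that subtracting the derivatives of a
    polynomial term by term gives a sequence of the same kind. *)
Definition derivs D (n : nat) h := forall k, (k < n)%N -> forall t, D t ->
  is_derive t 1 (h k) (h k.+1 t).

Lemma derivs_within_continuous D (f df : R -> R) (a b : R) :
  (forall t, D t -> is_derive t 1 f (df t)) -> `[a, b] `<=` D ->
  {within `[a, b], continuous f}.
Proof.
move=> fD sub; apply: derivable_within_continuous => t tab.
by have [] := fD _ (sub _ tab).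
Qed.

Lemma subset_itv_interval D (a b : R) : is_interval D -> D a -> D b ->
  `[a, b] `<=` D.
Proof. by move=> iD Da Db t /=; rewrite in_itv /=; apply: iD. Qed.

(** The factor [alpha] serves the chain [taylor_quot], where each derivative is a nonzero multiple
    of the next function. *)
Lemma Rolle_seq D (f df : R -> R) (alpha : R) (s : seq R) (x : R) :
  is_interval D -> alpha != 0 ->
  (forall t, D t -> is_derive t 1 f (alpha * df t)) ->
  path <%R x s -> (forall t, t \in x :: s -> D t /\ f t = 0) ->
  exists s', [/\ size s' = size s, path <%R x s' &
    forall t, t \in s' -> D t /\ df t = 0].
Proof.
move=> iD a0 fD; elim: s x => [|y s IH] x /= => [_ _|/andP[xy ys] zs].
  by exists [::].
have [s' [ss' ps' zs']] : exists s', [/\ size s' = size s, path <%R y s' &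
    forall t, t \in s' -> D t /\ df t = 0].
  by apply: IH => // t ts; apply: zs; rewrite inE ts orbT.
have [Dx fx] : D x /\ f x = 0 by apply: zs; rewrite inE eqxx.
have [Dy fy] : D y /\ f y = 0 by apply: zs; rewrite !inE eqxx orbT.
have sub := subset_itv_interval iD Dx Dy.
have sub' : `]x, y[ `<=` D.
  by apply: subset_trans sub; apply: subset_itv; rewrite bnd_simp.
have [|||c cxy cD] := Rolle xy (f := f).
- by move=> t txy; have [] := fD _ (sub' _ txy).
- exact: derivs_within_continuous fD sub.
- by rewrite fx fy.
have Dc := sub' _ cxy.
exists (c :: s'); split => /=; first by rewrite ss'.
  move: cxy; rewrite in_itv /= => /andP[-> cy] /=.
  by case: s' ps' {ss' zs'} => //= z s' /andP[yz ->]; rewrite (lt_trans cy yz).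
move=> t; rewrite inE => /predU1P[->|/zs' //]; split => //.
have [_ e1] := cD; have [_ e2] := fD _ Dc.
by move: e2; rewrite e1 => /esym/eqP; rewrite mulf_eq0 (negPf a0) => /eqP.
Qed.

Lemma Rolle_iter D (m : nat) g (alpha : nat -> R) (s : seq R) :
  is_interval D -> (forall k, (k < m)%N -> alpha k != 0) ->
  (forall k, (k < m)%N -> forall t, D t -> is_derive t 1 (g k) (alpha k * g k.+1 t)) ->
  uniq s -> size s = m.+1 -> (forall t, t \in s -> D t /\ g 0%N t = 0) ->
  exists2 xi, D xi & g m xi = 0.
Proof.
move=> iD; rewrite -(sort_lt_sorted s) -(size_sort <=%R s) => a0 gD ss ns zs.
have {zs} : forall t, t \in sort <=%R s -> D t /\ g 0%N t = 0.
  by move=> t; rewrite mem_sort; apply: zs.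
move: (sort <=%R s) ss ns => {}s.
elim: m g alpha a0 gD s => [|m IH] g alpha a0 gD [//|x s] /= ss [ns] zs.
  by have [Dx gx] := zs x (mem_head _ _); exists x.
have [s' [ss' ps' zs']] := Rolle_seq iD (a0 0%N isT) (gD 0%N isT) ss zs.
apply: (IH (fun k => g k.+1) (fun k => alpha k.+1) _ _ s' _ _ zs').
- by move=> k km; apply: a0.
- by move=> k km; apply: gD.
- exact: path_sorted ps'.
- by rewrite ss' ns.
Qed.

End iterated_Rolle.

(** * Mean value form of divided differences and interpolation error *)

Section interpolation_error.
Variable R : realType.
Implicit Types (D : set R) (h g : nat -> R -> R).

Lemma derivs_horner D (n : nat) (p : {poly R}) :
  derivs D n (fun k t => (p^`(k)).[t]).
Proof. by move=> k _ t _; rewrite derivnS; apply: is_derive_poly. Qed.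

Lemma derivsB D (n : nat) h g : derivs D n h -> derivs D n g ->
  derivs D n (fun k t => h k t - g k t).
Proof. by move=> hD gD k kn t Dt; apply: is_deriveB; [apply: hD|apply: gD]. Qed.

Lemma derivn_size (p : {poly R}) (n : nat) (t : R) : (size p <= n.+1)%N ->
  (p^`(n)).[t] = n`!%:R * p`_n.
Proof.
move=> sp; have : (size p^`(n) <= 1)%N.
  apply/leq_sizeP => j j1; rewrite coef_derivn nth_default ?mul0rn //.
  by apply: (leq_trans sp); rewrite -addn1 leq_add2l.
move=> /size1_polyC ->.
by rewrite hornerC coef_derivn addn0 ffactnn mulr_natl.
Qed.

(** The differences [h k - Q^(k)] form a chain that starts with [n + 1] zeros, and [Q^(n)] is the
    constant [n! Q_n]. *)
Lemma agree_derivn D (n : nat) h (Q : {poly R}) (s : seq R) : is_interval D ->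
  derivs D n h -> (size Q <= n.+1)%N -> uniq s -> size s = n.+1 ->
  (forall t, t \in s -> D t /\ h 0%N t = Q.[t]) ->
  exists2 xi, D xi & h n xi = n`!%:R * Q`_n.
Proof.
move=> iD hD sQ us ss zs.
have [|||||xi Dxi] := @Rolle_iter _ D n (fun k t => h k t - Q^`(k).[t]) (fun=> 1) s iD.
- by move=> *; apply: oner_neq0.
- move=> k kn t Dt; rewrite mul1r.
  exact: (derivsB hD (derivs_horner (n := n) Q)).
- exact: us.
- exact: ss.
- by move=> t /zs[Dt e]; split => //; rewrite derivn0 e subrr.
by rewrite derivn_size // => /eqP; rewrite subr_eq0 => /eqP e; exists xi.
Qed.

Lemma nodes_uniq (x : nat -> R) (N : nat) :
  (forall i j, (i < N)%N -> (j < N)%N -> x i = x j -> i = j) -> uniq (mkseq x N).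
Proof.
move=> xi; rewrite map_inj_in_uniq ?iota_uniq // => i j.
by rewrite !mem_iota => /andP[_ ik] /andP[_ jk]; apply: xi.
Qed.

Lemma divdiff_MVT D (n : nat) h (x : nat -> R) : is_interval D ->
  derivs D n h ->
  (forall i j, (i < n.+1)%N -> (j < n.+1)%N -> x i = x j -> i = j) ->
  (forall i, (i < n.+1)%N -> D (x i)) ->
  exists2 xi, D xi & h n xi = n`!%:R * divdiff x (h 0%N) n.
Proof.
move=> iD hD xi Dx.
have := @agree_derivn D n h (interp x (h 0%N) n.+1) (mkseq x n.+1) iD hD.
rewrite coef_interp; apply.
- exact: size_interp.
- exact: nodes_uniq.
- by rewrite size_mkseq.
move=> _ /mapP[i + ->]; rewrite mem_iota => /andP[_ ik].
by rewrite (interp_node xi) //; split => //; apply: Dx.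
Qed.

Lemma interp_error D (n : nat) h (x : nat -> R) (M t : R) : is_interval D ->
  derivs D n h ->
  (forall i j, (i < n)%N -> (j < n)%N -> x i = x j -> i = j) ->
  (forall i, (i < n)%N -> D (x i)) -> D t -> (forall u, D u -> `|h n u| <= M) ->
  `|h 0%N t - (interp x (h 0%N) n).[t]| <= M * `|(node_poly x n).[t]|.
Proof.
move=> iD hD xi Dx Dt hM.
have M0 : 0 <= M by apply: le_trans (hM _ Dt).
have [/mapP[i + ->]|tx] := boolP (t \in mkseq x n).
  rewrite mem_iota => /andP[_ ik].
  by rewrite (interp_node xi) // subrr normr0 mulr_ge0.
have w0 : (node_poly x n).[t] != 0.
  rewrite horner_prod; apply/prodf_neq0 => l _; rewrite hornerXsubC subr_eq0.
  apply: contra tx => /eqP ->; apply/mapP; exists (l : nat) => //.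
  by rewrite mem_iota /=.
(* This [kap] makes [interp + kap *: node_poly] agree with [h 0] at [t] as well, hence at [n + 1]
   points. *)
set kap := (h 0%N t - (interp x (h 0%N) n).[t]) / (node_poly x n).[t].
have sI : (size (interp x (h 0%N) n) <= n)%N by apply: size_interp.
have [||||xi' Dxi] := @agree_derivn D n h
  (interp x (h 0%N) n + kap *: node_poly x n) (t :: mkseq x n) iD hD.
- apply: (leq_trans (size_polyD _ _)); rewrite geq_max leqW //=.
  by apply: (leq_trans (size_scale_leq _ _)); rewrite size_node_poly.
- by rewrite /= tx nodes_uniq.
- by rewrite /= size_mkseq.
- move=> u; rewrite inE => /predU1P[->|/mapP[i + ->]].
    by split => //; rewrite hornerD hornerZ divfK // addrC subrK.
  rewrite mem_iota => /andP[_ ik]; split; first exact: Dx.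
  by rewrite hornerD hornerZ node_poly_node // mulr0 addr0 (interp_node xi).
rewrite coefD coefZ coef_node_poly nth_default // add0r mulr1 => e.
have -> : h 0%N t - (interp x (h 0%N) n).[t] = kap * (node_poly x n).[t].
  by rewrite divfK.
rewrite normrM ler_wpM2r //; apply: le_trans (hM _ Dxi).
by rewrite e [X in _ <= X]normrM ler_peMl // normr_nat ler1n fact_gt0.
Qed.

End interpolation_error.

(** * Interpolation inequalities for intermediate derivatives *)

Section landau.
Variable R : realType.
Implicit Types (D : set R) (h g : nat -> R -> R).

Lemma divdiff_bound (f : R -> R) (x : nat -> R) (n : nat) (A B : R) : 0 < B ->
  (forall i, (i <= n)%N -> `|f (x i)| <= A) ->
  (forall i, (i <= n)%N -> B <= `|node_prod x n.+1 i|) ->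
  `|divdiff x f n| <= n.+1%:R * A / B.
Proof.
move=> B0 fA xB; apply: (le_trans (ler_norm_sum _ _ _)).
rewrite -mulrA -[n.+1 in X in _ <= X]card_ord -sumr_const mulr_suml.
apply: ler_sum => i _; rewrite mul1r normrM normfV ler_pM //.
  by apply: fA; rewrite -ltnS.
by rewrite lef_pV2 ?posrE ?(lt_le_trans B0) // xB // -ltnS.
Qed.

(* Descending induction on the order of the derivative: a divided difference at
   equispaced nodes bounds [h j] at one point, and [h j.+1] controls the rest. *)
Lemma landau_kolmogorov_step (n : nat) : (0 < n)%N -> forall m, (m <= n)%N ->
  exists2 c : R, 1 <= c & forall (a b A : R) h, a < b -> derivs `[a, b] n h ->
    (forall t, `[a, b]%classic t -> `|h 0%N t| <= A) ->
    (forall t, `[a, b]%classic t -> `|h n t| * (b - a) ^+ n <= A) ->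
    forall j, (n - m <= j)%N -> (j <= n)%N -> forall t, `[a, b]%classic t ->
      `|h j t| * (b - a) ^+ j <= c * A.
Proof.
move=> n0; elim=> [|m IH] mn.
  exists 1 => // a b A h ab hD h0 hn j; rewrite subn0 => nj jn t tab.
  have -> : j = n by apply/eqP; rewrite eqn_leq nj jn.
  by rewrite mul1r hn.
have [c c1 cP] := IH (ltnW mn).
pose j0 := (n - m.+1)%N.
have j0n : (j0 < n)%N by rewrite /j0 ltn_subrL n0.
have j0S : j0.+1 = (n - m)%N by rewrite /j0 subnSK.
pose c' := j0`!%:R * j0.+1%:R * n%:R ^+ j0 : R.
have c'0 : 0 <= c' by rewrite !mulr_ge0 // exprn_ge0.
exists (c' + c); first by rewrite (le_trans c1) // lerDr.
move=> a b A h ab hD h0 hn j; rewrite leq_eqVlt => /predU1P[<-|jj] jn t tab; last first.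
  apply: (le_trans (cP a b A h ab hD h0 hn j _ jn t tab)).
    by rewrite -j0S.
  by rewrite ler_wpM2r ?lerDr //; apply: le_trans (h0 _ tab).
have ba0 : 0 < b - a by rewrite subr_gt0.
have nR0 : 0 < n%:R :> R by rewrite ltr0n.
(* The spacing [(b - a) / n] leaves room for [n + 1] nodes in [[a, b]]; the first [j0 + 1] are
   used. *)
pose x i := a + i%:R * ((b - a) / n%:R).
have dx0 : 0 < (b - a) / n%:R by rewrite divr_gt0.
have xD i k : x i - x k = (i%:R - k%:R) * ((b - a) / n%:R) by rewrite /x; ring.
have xinj i k : x i = x k -> i = k.
  move/eqP; rewrite -subr_eq0 xD mulf_eq0 (gt_eqF dx0) orbF subr_eq0 eqr_nat.
  by move/eqP.
have xab i : (i <= n)%N -> `[a, b]%classic (x i).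
  move=> iN; rewrite /= in_itv /= /x lerDl mulr_ge0 ?(ltW dx0) //=.
  rewrite -lerBrDl mulrCA ler_piMr ?(ltW ba0) //.
  by rewrite ler_pdivrMr // mul1r ler_nat.
have itv := @interval_is_interval R `[a, b].
have [|||xi xiab hxi] := @divdiff_MVT _ _ j0 h x itv.
- by move=> k kj; apply: hD; apply: ltn_trans j0n.
- by move=> i k _ _; apply: xinj.
- by move=> i ij; apply: xab; apply: leq_trans (ltnW j0n).
have dd : `|divdiff x (h 0%N) j0| <= j0.+1%:R * A / ((b - a) / n%:R) ^+ j0.
  apply: divdiff_bound; first by rewrite exprn_gt0.
    by move=> i ij; apply: h0; apply: xab; apply: leq_trans ij (ltnW j0n).
  move=> i ij; rewrite normr_prod.
  have -> : ((b - a) / n%:R) ^+ j0 = \prod_(l < j0.+1 | l != i :> nat) ((b - a) / n%:R).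
    rewrite prodr_const; congr (_ ^+ _).
    have ij' : (i < j0.+1)%N by [].
    rewrite -[LHS]/(j0.+1.-1) -[j0.+1 in LHS]card_ord -(cardC1 (Ordinal ij')).
    exact: eq_card.
  apply: ler_prod => l li; rewrite (ltW dx0) /= xD normrM (gtr0_norm dx0).
  rewrite ler_peMl ?(ltW dx0) //.
  (* A nonzero integer has absolute value at least 1, so distinct nodes are at least one step
     apart. *)
  rewrite -[i%:R]/((i : int)%:~R) -[l%:R]/((l : int)%:~R) -intrB -intr_norm.
  rewrite (_ : 1 = 1%:~R) // ler_int -gtz0_ge1 normr_gt0 subr_eq0.
  by apply: contra li => /eqP [->].
have hxi' : `|h j0 xi| * (b - a) ^+ j0 <= c' * A.
  rewrite hxi normrM normr_nat -mulrA.
  apply: (@le_trans _ _ (j0`!%:R * (j0.+1%:R * A / ((b - a) / n%:R) ^+ j0 * (b - a) ^+ j0))).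
    by rewrite ler_wpM2l // ler_wpM2r // exprn_ge0 // ltW.
  rewrite le_eqVlt; apply/orP; left; apply/eqP.
  rewrite /c' expr_div_n; field.
  by rewrite !expf_neq0 ?gt_eqF.
have hS u : `[a, b]%classic u -> `|h j0.+1 u| * (b - a) ^+ j0.+1 <= c * A.
  by move=> uab; apply: (cP a b A h ab hD h0 hn) => //; rewrite j0S.
(* By the mean value theorem the oscillation of [h j0] is at most [b - a] times a bound for
   [h j0.+1], which [hS] supplies. *)
have key u v : `[a, b]%classic u -> `[a, b]%classic v -> u <= v ->
    `|h j0 v - h j0 u| * (b - a) ^+ j0 <= c * A.
  move=> uab vab uv.
  have sub := subset_itv_interval itv uab vab.
  have [||w wuv e] := @MVT_segment _ (h j0) (h j0.+1) u v uv.
  - move=> w wuv; apply: hD => //; apply: sub.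
    by move: wuv; apply: subset_itv; rewrite bnd_simp.
  - by apply: derivs_within_continuous sub => w; apply: hD.
  rewrite e normrM.
  apply: le_trans (hS _ (sub _ wuv)); rewrite exprS mulrA.
  rewrite ler_wpM2r ?exprn_ge0 ?(ltW ba0) // ler_wpM2l //.
  move: uab vab; rewrite /= !in_itv /= => /andP[au _] /andP[_ vb].
  by rewrite ger0_norm ?subr_ge0 // lerB.
have key2 : `|h j0 t - h j0 xi| * (b - a) ^+ j0 <= c * A.
  have [xt|tx] := leP xi t; first exact: key.
  by rewrite distrC; apply: key => //; apply: ltW.
rewrite mulrDl; apply: (le_trans _ (lerD hxi' key2)).
rewrite -mulrDl ler_wpM2r ?exprn_ge0 ?(ltW ba0) //.
by rewrite -{1}(subrK (h j0 xi) (h j0 t)) addrC ler_normD.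
Qed.

Lemma landau_kolmogorov (n : nat) : (0 < n)%N ->
  exists2 c : R, 1 <= c & forall (a b A : R) h, a < b -> derivs `[a, b] n h ->
    (forall t, `[a, b]%classic t -> `|h 0%N t| <= A) ->
    (forall t, `[a, b]%classic t -> `|h n t| * (b - a) ^+ n <= A) ->
    forall j, (j <= n)%N -> forall t, `[a, b]%classic t ->
      `|h j t| * (b - a) ^+ j <= c * A.
Proof.
move=> n0; have [c c1 cP] := landau_kolmogorov_step n0 (leqnn n).
exists c => // a b A h ab hD h0 hn j jn.
by apply: cP; rewrite ?subnn.
Qed.

End landau.

(** * Derivatives of products and of powers of [b - u] *)

Section pointwise_derivatives.
Variables (R : realType) (t : R).
Implicit Types f g : R -> R.

Lemma is_derive_mul f g (df dg : R) : is_derive t 1 f df -> is_derive t 1 g dg ->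
  is_derive t 1 (fun u => f u * g u) (df * g t + f t * dg).
Proof.
move=> fD gD; have := is_deriveM fD gD; congr is_derive.
by rewrite /GRing.scale /= addrC [g t * df]mulrC.
Qed.

Lemma is_derive_mulr f (c df : R) : is_derive t 1 f df ->
  is_derive t 1 (fun u => f u * c) (df * c).
Proof.
move=> fD; have := is_derive_mul fD (is_derive_cst c t 1); congr is_derive.
by rewrite mulr0 addr0.
Qed.

Lemma is_derive_subl (b : R) : is_derive t 1 (fun u : R => b - u) (-1).
Proof. by rewrite -[X in is_derive _ _ _ X]add0r; apply: is_deriveB. Qed.

Lemma is_derive_subl_pow (b : R) (k : nat) :
  is_derive t 1 (fun u : R => (b - u) ^+ k) (- (k%:R * (b - t) ^+ k.-1)).
Proof.
elim: k => [|k IH]; first by rewrite mul0r oppr0; apply: is_derive_cst.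
have := is_derive_mul (is_derive_subl b) IH.
have -> : (fun u => (b - u) * (b - u) ^+ k) = (fun u => (b - u) ^+ k.+1).
  by apply/funext => u; rewrite exprS.
congr is_derive; case: k {IH} => [|k] /=; first by rewrite expr0; ring.
by rewrite exprS -[k.+2%:R]natr1; ring.
Qed.

End pointwise_derivatives.

(** * Taylor sums and their quotients *)

Section taylor_chain.
Variables (R : realType) (h : nat -> R -> R) (b : R).

(* [taylor_sum n t] is the Taylor polynomial of order [n-1] at [t] evaluated at
   [b], and [taylor_quot n t] its quotient by [(b - t)^n]. The rule
   [taylor_quot k ' = k * taylor_quot k.+1] makes Rolle's theorem iterable. *)
Fixpoint taylor_quot (k : nat) (t : R) : R :=
  if k is j.+1 then (taylor_quot j t + h j t / j`!%:R) / (b - t) else 0.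

Fixpoint taylor_sum (k : nat) (t : R) : R :=
  if k is j.+1 then taylor_sum j t + h j t * (b - t) ^+ j / j`!%:R else 0.

Lemma taylor_sum_quot (k : nat) (t : R) : t < b ->
  taylor_sum k t = taylor_quot k t * (b - t) ^+ k.
Proof.
move=> tb; have bt : b - t != 0 by rewrite subr_eq0 gt_eqF.
elim: k => [|k IH] /=; first by rewrite mul0r.
by rewrite IH exprS mulrA divfK // mulrDl [h k t * _ / _]mulrAC.
Qed.

Lemma taylor_sum_end (k : nat) : taylor_sum k.+1 b = h 0%N b.
Proof.
elim: k => [|k IH]; first by rewrite /= add0r expr0 mulr1 divr1.
by rewrite [LHS]/= -/(taylor_sum k.+1 b) IH subrr expr0n /= mulr0 mul0r addr0.
Qed.

(** In the product rule, the term from differentiating [1 / (b - t)] is [taylor_quot k.+1 / (b - t)]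
    again, which raises the coefficient from [k] to [k + 1]. *)
Lemma is_derive_taylor_quot (D : set R) (n : nat) (t : R) : derivs D n h -> D t -> t < b ->
  forall k, (k <= n)%N ->
  is_derive t 1 (taylor_quot k) (k%:R * taylor_quot k.+1 t).
Proof.
move=> hD Dt tb.
have bt : b - t != 0 by rewrite subr_eq0 gt_eqF.
elim=> [_|k IH kn].
  by rewrite mul0r; apply: is_derive_cst.
have D1 : is_derive t 1 (fun u => taylor_quot k u + h k u / k`!%:R)
    (k%:R * taylor_quot k.+1 t + h k.+1 t / k`!%:R).
  apply: is_deriveD; first by apply: IH; apply: ltnW.
  by apply: is_derive_mulr; apply: hD.
have D2 : is_derive t 1 (fun u => (b - u)^-1) ((b - t) ^- 2).
  have := @is_deriveV _ (fun u : R => b - u) t (-1) 1 bt (is_derive_subl t b).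
  by rewrite scaleNr scalerN opprK; congr is_derive; rewrite [LHS]mulr1.
have := is_derive_mul D1 D2; congr is_derive.
rewrite /=.
have kf : k`!%:R != 0 :> R by rewrite pnatr_eq0 -lt0n fact_gt0.
have kS : k.+1%:R != 0 :> R by rewrite pnatr_eq0.
rewrite factS natrM -natr1; field.
by rewrite bt kf natr1 kS.
Qed.

(** The derivative telescopes: differentiating [(b - t)^k] in the new term cancels the derivative of
    the preceding sum. *)
Lemma is_derive_taylor_sum (D : set R) (n : nat) (t : R) : derivs D n h -> D t ->
  forall k, (k < n)%N ->
  is_derive t 1 (taylor_sum k.+1) (h k.+1 t * (b - t) ^+ k / k`!%:R).
Proof.
move=> hD Dt.
have step k df : (k < n)%N -> is_derive t 1 (taylor_sum k) df ->
    is_derive t 1 (taylor_sum k.+1)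
      (df + (h k.+1 t * (b - t) ^+ k - h k t * (k%:R * (b - t) ^+ k.-1)) / k`!%:R).
  move=> kn dfP; apply: is_deriveD.
  apply: is_derive_mulr.
  have := is_derive_mul (hD k kn t Dt) (is_derive_subl_pow t b k).
  by congr is_derive; rewrite mulrN.
elim=> [|k IH] kn.
  have := step 0%N 0 kn (is_derive_cst _ _ _); congr is_derive.
  by rewrite mul0r mulr0 subr0 add0r.
have := step _ _ kn (IH (ltnW kn)); congr is_derive.
have kf : k`!%:R != 0 :> R by rewrite pnatr_eq0 -lt0n fact_gt0.
have kS : k.+1%:R != 0 :> R by rewrite pnatr_eq0.
rewrite factS natrM /= -natr1; field.
by rewrite kf natr1 kS.
Qed.

End taylor_chain.

(** * Nearest points of a closed set *)

Section closed_neighbours.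
Variables (R : realType) (K : set R).
Hypothesis cK : closed K.

Lemma closed_max_le (x0 t : R) : K x0 -> x0 <= t ->
  exists u, [/\ K u, x0 <= u, u <= t & forall w, K w -> w <= t -> w <= u].
Proof.
move=> Kx0 x0t.
have [|||u] := @compact_EVT_max R R id (K `&` `[x0, t]).
- by exists x0; split => //=; rewrite in_itv /= lexx x0t.
- by rewrite setIC; apply: compact_closedI => //; apply: segment_compact.
- by apply: continuous_subspaceT => z.
rewrite inE => -[Ku]; rewrite /= in_itv /= => /andP[xu ut] umax.
exists u; split => // w Kw wt; have [x0w|/ltW wx0] := leP x0 w.
  by apply: umax; rewrite inE; split => //=; rewrite in_itv /= x0w.
exact: le_trans wx0 xu.
Qed.

Lemma closed_min_ge (x0 t : R) : K x0 -> t <= x0 ->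
  exists v, [/\ K v, t <= v, v <= x0 & forall w, K w -> t <= w -> v <= w].
Proof.
move=> Kx0 x0t.
have [|||u] := @compact_EVT_min R R id (K `&` `[t, x0]).
- by exists x0; split => //=; rewrite in_itv /= lexx x0t.
- by rewrite setIC; apply: compact_closedI => //; apply: segment_compact.
- by apply: continuous_subspaceT => z.
rewrite inE => -[Ku]; rewrite /= in_itv /= => /andP[xu ut] umin.
exists u; split => // w Kw wt; have [x0w|/ltW wx0] := leP w x0.
  by apply: umin; rewrite inE; split => //=; rewrite in_itv /= x0w andbT.
exact: le_trans ut wx0.
Qed.

End closed_neighbours.

(** * Inequalities for powers and slopes *)

Section real_inequalities.
Variable R : realType.

Lemma exprD_superadd (x y : R) (n : nat) : 0 <= x -> 0 <= y ->
  x ^+ n.+1 + y ^+ n.+1 <= (x + y) ^+ n.+1.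
Proof.
move=> x0 y0; elim: n => [|n IH]; first by rewrite !expr1.
rewrite (exprS (x + y)); apply: (le_trans _ (ler_wpM2l (addr_ge0 x0 y0) IH)).
rewrite !(exprS _ n.+1) -subr_ge0.
have -> : (x + y) * (x ^+ n.+1 + y ^+ n.+1) - (x * x ^+ n.+1 + y * y ^+ n.+1) =
  y * x ^+ n.+1 + x * y ^+ n.+1 by ring.
by rewrite addr_ge0 // mulr_ge0 // exprn_ge0.
Qed.

(** Induction; the defect in the step is [p (1 - p) (x - y) (x^n - y^n)], whose last two factors
    have the same sign. *)
Lemma exprn_convex (x y p : R) (n : nat) : 0 <= x -> 0 <= y -> 0 <= p -> p <= 1 ->
  ((1 - p) * x + p * y) ^+ n <= (1 - p) * x ^+ n + p * y ^+ n.
Proof.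
move=> x0 y0 p0 p1.
have q0 : 0 <= 1 - p by rewrite subr_ge0.
elim: n => [|n IH]; first by rewrite !expr0 !mulr1 subrK.
have z0 : 0 <= (1 - p) * x + p * y by rewrite addr_ge0 // mulr_ge0.
rewrite exprS; apply: (le_trans (ler_wpM2l z0 IH)).
rewrite -subr_ge0 !exprS.
have -> : (1 - p) * (x * x ^+ n) + p * (y * y ^+ n) -
   ((1 - p) * x + p * y) * ((1 - p) * x ^+ n + p * y ^+ n) =
   (1 - p) * p * ((x - y) * (x ^+ n - y ^+ n)) by ring.
apply: mulr_ge0; first by rewrite mulr_ge0.
have [xy|/ltW yx] := leP x y.
  by rewrite mulr_le0 // subr_le0 // lerXn2r.
by rewrite mulr_ge0 // subr_ge0 // lerXn2r.
Qed.

(** Caratheodory's slope function is continuous at [t] with value [d] there, so it stays positive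
    nearby. *)
Lemma is_derive_pos_right (f : R -> R) (t d : R) : is_derive t 1 f d -> 0 < d ->
  exists2 e, 0 < e & forall u, t < u -> u < t + e -> f t < f u.
Proof.
move=> /is_derive1_caratheodory[g [fg gc gt]] d0.
have : \forall u \near t, 0 < g u.
  by apply: (cvgr_gt _ gc); rewrite gt.
case/nbhs_ballP => e /= e0 eP; exists e => // u tu ute.
rewrite -subr_gt0 fg mulr_gt0 ?subr_gt0 //; apply: eP.
by rewrite /ball /= ltr_distlC; apply/andP; split; lra.
Qed.

End real_inequalities.

(** * Growth of a weighted primitive of [g] when [g >= m] on [K_eps] *)

Section growth.
Variables (R : realType) (I K : set R) (eps m b : R) (g G : R -> R) (n : nat).
Hypotheses (iI : is_interval I) (cK : closed K) (KI : K `<=` I).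
Hypotheses (eps0 : 0 < eps) (eps1 : eps < 1) (m0 : 0 <= m) (Kb : K b).
Hypothesis g_ge0 : forall t, I t -> 0 <= g t.
Hypothesis g_ge : forall t, K_eps I K eps t -> m <= g t.
Hypothesis GD : forall t, I t ->
  is_derive t 1 G (g t * (n.+1%:R * (b - t) ^+ n)).

(** The function [G + c (b - .)^(n+1)] has derivative [g - c] times the nonnegative weight
    [(n + 1) (b - .)^n]. *)
Lemma increment_ge (s t c : R) : I s -> s <= t -> t <= b ->
  (forall u, s <= u <= t -> c <= g u) ->
  c * ((b - s) ^+ n.+1 - (b - t) ^+ n.+1) <= G t - G s.
Proof.
move=> Is st tb cg.
have sub : `[s, t] `<=` I.
  by apply: subset_itv_interval => //; apply: (iI Is (KI Kb)); rewrite st.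
pose F u := G u + (b - u) ^+ n.+1 * c.
have FD u : I u -> is_derive u 1 F ((g u - c) * (n.+1%:R * (b - u) ^+ n)).
  move=> Iu.
  have := is_deriveD (GD Iu) (is_derive_mulr c (is_derive_subl_pow u b n.+1)).
  by congr is_derive => /=; ring.
have [||w] := @MVT_segment _ F (fun u => (g u - c) * (n.+1%:R * (b - u) ^+ n)) s t st.
- move=> w wst; apply: FD; apply: sub.
  by move: wst; apply: subset_itv; rewrite bnd_simp.
- by apply: derivs_within_continuous sub => w; apply: FD.
rewrite in_itv /= => /andP[sw wt] e.
rewrite -subr_ge0.
have -> : G t - G s - c * ((b - s) ^+ n.+1 - (b - t) ^+ n.+1) = F t - F s.
  by rewrite /F; ring.
by rewrite e !mulr_ge0 ?exprn_ge0 ?subr_ge0 ?cg ?sw // (le_trans wt).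
Qed.

Lemma increment_ge0 (s t : R) : I s -> s <= t -> t <= b -> G s <= G t.
Proof.
move=> Is st tb; rewrite -subr_ge0.
have := @increment_ge s t 0 Is st tb; rewrite mul0r; apply.
move=> u /andP[su ut]; apply: g_ge0; apply: (iI Is (KI Kb)).
by rewrite su (le_trans ut).
Qed.

Lemma dist_left_le (u t : R) : K u -> u <= t -> dist_left K t <= t - u.
Proof.
move=> Ku ut; apply: ge_inf; first by exists 0 => d [].
by split; rewrite ?subr_ge0 // subKr.
Qed.

Lemma dist_right_le (v t : R) : K v -> t <= v -> dist_right K t <= v - t.
Proof.
move=> Kv tv; apply: ge_inf; first by exists 0 => d [].
by split; rewrite ?subr_ge0 // addrC subrK.
Qed.

Lemma dist_left_ge (u t : R) : K u -> u <= t -> (forall w, K w -> w <= t -> w <= u) ->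
  t - u <= dist_left K t.
Proof.
move=> Ku ut umax; apply: lb_le_inf.
  by exists (t - u); split; rewrite ?subr_ge0 // subKr.
move=> d [d0 Kd]; have := umax _ Kd; rewrite gerBl => /(_ d0); lra.
Qed.

Lemma dist_right_ge (v t : R) : K v -> t <= v -> (forall w, K w -> t <= w -> v <= w) ->
  v - t <= dist_right K t.
Proof.
move=> Kv tv vmin; apply: lb_le_inf.
  by exists (v - t); split; rewrite ?subr_ge0 // addrC subrK.
move=> d [d0 Kd]; have := vmin _ Kd; rewrite lerDl => /(_ d0); lra.
Qed.

(** In this part of the gap [t - u <= eps / 2 * (v - u)], while [v - t >= (v - u) / 2] because
    [eps < 1]; hence [t] lies in [K] or in [K_left]. *)
Lemma gap_left (u v t : R) : K u -> K v ->
  (forall w, K w -> w < v -> w <= u) -> (forall w, K w -> u < w -> v <= w) ->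
  u <= t -> t <= u + eps / 2 * (v - u) -> u < v -> m <= g t.
Proof.
have [e0 e1] := (eps0, eps1).
move=> Ku Kv wu vw ut tu uv.
have e2 : eps / 2 * (v - u) <= 2^-1 * (v - u).
  by rewrite ler_wpM2r //; lra.
have [ut'|tu'] := ltP u t; last first.
  have -> : t = u by apply/eqP; rewrite eq_le tu'.
  by apply: g_ge; left; left.
have tv : t < v by lra.
apply: g_ge; right; split.
- by apply: (iI (KI Ku) (KI Kv)); rewrite ut ltW.
- by split; [exists u|exists v => //; apply: ltW].
have dl := dist_left_le Ku ut.
have dr := @dist_right_ge v t Kv (ltW tv).
have {}dr : v - t <= dist_right K t.
  by apply: dr => w Kw tw; apply: vw => //; apply: lt_le_trans tw.
apply: (le_trans dl); apply: (@le_trans _ _ (eps * (v - t))); last first.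
  by rewrite ler_wpM2l // ltW.
have : eps * (2^-1 * (v - u)) <= eps * (v - t) by rewrite ler_wpM2l ?(ltW eps0) //; lra.
lra.
Qed.

Lemma gap_right (u v t : R) : K u -> K v ->
  (forall w, K w -> w < v -> w <= u) -> (forall w, K w -> u < w -> v <= w) ->
  t <= v -> v - eps / 2 * (v - u) <= t -> u < v -> m <= g t.
Proof.
have [e0 e1] := (eps0, eps1).
move=> Ku Kv wu vw tv tu uv.
have e2 : eps / 2 * (v - u) <= 2^-1 * (v - u).
  by rewrite ler_wpM2r //; lra.
have [tv'|vt'] := ltP t v; last first.
  have -> : t = v by apply/eqP; rewrite eq_le tv.
  by apply: g_ge; left; left.
have ut : u < t by lra.
apply: g_ge; left; right; split.
- by apply: (iI (KI Ku) (KI Kv)); rewrite tv ltW.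
- by split; [exists u => //; apply: ltW|exists v].
have dl := dist_right_le Kv tv.
have dr := @dist_left_ge u t Ku (ltW ut).
have {}dr : t - u <= dist_left K t.
  by apply: dr => w Kw wt; apply: wu => //; apply: le_lt_trans tv'.
apply: (le_trans dl); apply: (@le_trans _ _ (eps * (t - u))); last first.
  by rewrite ler_wpM2l // ltW.
have : eps * (2^-1 * (v - u)) <= eps * (t - u) by rewrite ler_wpM2l ?(ltW eps0) //; lra.
lra.
Qed.

(* A maximiser over [K] of [G + eps/4 m (b - .)^(n+1)] must be [b]: the
   function increases to the right of each point of [K] and across each gap. *)
Lemma growth_on (s : R) : K s -> s <= b ->
  eps / 4 * m * (b - s) ^+ n.+1 <= G b - G s.
Proof.
have [e0 e1] := (eps0, eps1).
move=> Ks sb.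
have [m_eq0|mn0] := eqVneq m 0.
  by rewrite m_eq0 mulr0 mul0r subr_ge0 increment_ge0 //; apply: KI.
have {mn0} mgt0 : 0 < m by rewrite lt_def mn0.
pose H t := G t + (b - t) ^+ n.+1 * (eps / 4 * m).
have HD t : I t -> is_derive t 1 H ((g t - eps / 4 * m) * (n.+1%:R * (b - t) ^+ n)).
  move=> It.
  have := is_deriveD (GD It)
    (is_derive_mulr (eps / 4 * m) (is_derive_subl_pow t b n.+1)).
  by congr is_derive => /=; ring.
suff : H s <= H b.
  rewrite /H subrr expr0n mul0r addr0; lra.
have sub := subset_itv_interval iI (KI Ks) (KI Kb).
have [|||t] := @compact_EVT_max R R H (K `&` `[s, b]).
- by exists s; split => //=; rewrite in_itv /= lexx sb.
- by rewrite setIC; apply: compact_closedI => //; apply: segment_compact.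
- apply: (@continuous_subspaceW _ _ _ `[s, b]); first exact: subIsetr.
  by apply: derivs_within_continuous sub => w; apply: HD.
rewrite inE => -[Kt]; rewrite /= in_itv /= => /andP[st tb] tmax.
have Hst : H s <= H t by apply: tmax; rewrite inE; split => //=; rewrite in_itv /= lexx sb.
move: (tb); rewrite le_eqVlt => /predU1P[<- //|tltb].
suff [v [Kv tv vb]] : exists v, [/\ K v, t < v, v <= b & H t < H v].
  move=> Htv; have : H v <= H t.
    by apply: tmax; rewrite inE; split => //=; rewrite in_itv /= (le_trans st (ltW tv)).
  by rewrite leNgt Htv.
have gt : m <= g t by apply: g_ge; left; left.
have em : eps / 4 * m < m by rewrite gtr_pMl //; lra.
(* At [t] the derivative of [H] is positive, because [g t >= m > eps / 4 * m]. *)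
have [|e de0 eP] := is_derive_pos_right (HD t (KI Kt)).
  by rewrite !mulr_gt0 ?exprn_gt0 ?subr_gt0 // (lt_le_trans em).
pose t0 := t + Num.min e (b - t) / 2.
have me : 0 < Num.min e (b - t) by rewrite lt_min de0 subr_gt0.
have tt0 : t < t0 by rewrite /t0; lra.
have t0e : t0 < t + e.
  have : Num.min e (b - t) <= e by rewrite ge_min lexx.
  by rewrite /t0; lra.
have t0b : t0 <= b.
  have : Num.min e (b - t) <= b - t by rewrite ge_min lexx orbT.
  by rewrite /t0; lra.
have [v [Kv t0v vb vmin]] := closed_min_ge cK Kb t0b.
have [u [Ku tu ut0 umax]] := closed_max_le cK Kt (ltW tt0).
(* Either [K] meets []t, t0]], where [H] exceeds [H t], or []t, v[] is a gap of [K]. *)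
move: (tu); rewrite le_eqVlt => /predU1P[ut|ltu]; last first.
  exists u; split => //; first exact: le_trans t0b.
  by apply: eP => //; apply: le_lt_trans t0e.
have tv : t < v by apply: lt_le_trans t0v.
exists v; split => //.
have wu w : K w -> w < v -> w <= t.
  move=> Kw wv; rewrite ut; apply: umax => //; rewrite leNgt; apply/negP => t0w.
  by have := vmin _ Kw (ltW t0w); rewrite leNgt wv.
have vw w : K w -> t < w -> v <= w.
  by move=> Kw tw; rewrite leNgt; apply/negP => /(wu _ Kw); rewrite leNgt tw.
(* On [[t, t1]], the first [eps / 2] of the gap, [g >= m]. By convexity of powers this piece yields
   an [eps / 2] share of [m * ((b - t)^(n+1) - (b - v)^(n+1))], twice what the second term of [H]
   loses. *)
pose t1 := t + eps / 2 * (v - t).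
have e2 : eps / 2 * (v - t) <= 2^-1 * (v - t) by rewrite ler_wpM2r //; lra.
have e2' : 0 < eps / 2 * (v - t) by rewrite mulr_gt0 ?subr_gt0 ?divr_gt0.
have tt1 : t <= t1 by rewrite /t1; lra.
have t1v : t1 <= v by rewrite /t1; lra.
have i1 : m * ((b - t) ^+ n.+1 - (b - t1) ^+ n.+1) <= G t1 - G t.
  apply: increment_ge => //; first exact: KI.
    exact: le_trans vb.
  by move=> w /andP[tw wt1]; apply: (@gap_left t v).
have i2 : G t1 <= G v.
  apply: increment_ge0 => //; apply: (iI (KI Kt) (KI Kv)).
  by rewrite tt1.
have i3 : (b - t1) ^+ n.+1 <= (1 - eps / 2) * (b - t) ^+ n.+1 + eps / 2 * (b - v) ^+ n.+1.
  have -> : b - t1 = (1 - eps / 2) * (b - t) + eps / 2 * (b - v) by rewrite /t1; ring.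
  by apply: exprn_convex; rewrite ?subr_ge0 //; lra.
have i4 : (b - v) ^+ n.+1 < (b - t) ^+ n.+1.
  by rewrite ltrXn2r ?nnegrE ?subr_ge0 //; lra.
have i5 : m * (eps / 2 * ((b - t) ^+ n.+1 - (b - v) ^+ n.+1)) <=
    m * ((b - t) ^+ n.+1 - (b - t1) ^+ n.+1).
  by rewrite ler_wpM2l //; lra.
have i6 : 0 < m * (eps * ((b - t) ^+ n.+1 - (b - v) ^+ n.+1)).
  by rewrite !mulr_gt0 // subr_gt0.
rewrite /H; lra.
Qed.

(** Now [xi] may lie in a gap. If the next point [v] of [K] is at most halfway to [b], [growth_on]
    from [v] suffices. Otherwise the gap around [xi] is long, and its last [eps / 2], cut off at
    [xi], contributes enough. *)
Lemma growth (u0 xi : R) : K u0 -> u0 <= xi -> xi < b ->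
  (eps / 8) ^+ n.+1 * m * (b - xi) ^+ n.+1 <= G b - G xi.
Proof.
have [e0 e1] := (eps0, eps1).
move=> Ku0 u0xi xib.
have Ixi : I xi by apply: (iI (KI Ku0) (KI Kb)); rewrite u0xi ltW.
have [v [Kv xiv vb vmin]] := closed_min_ge cK Kb (ltW xib).
have [u [Ku u0u uxi umax]] := closed_max_le cK Ku0 u0xi.
have Gxv := increment_ge0 Ixi xiv vb.
have Gvb := increment_ge0 (KI Kv) vb (lexx b).
have bx0 : 0 <= b - xi by rewrite subr_ge0 ltW.
have e80 : 0 <= eps / 8 by rewrite divr_ge0 // ltW.
have [h1|h2] := leP ((b - xi) / 2) (b - v).
  apply: (@le_trans _ _ (G b - G v)); last by rewrite lerD2l lerN2.
  apply: le_trans (growth_on Kv vb).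
  suff : (eps / 8) ^+ n.+1 * (b - xi) ^+ n.+1 <= eps / 4 * (b - v) ^+ n.+1.
    by move=> /(ler_wpM2l m0); lra.
  have -> : eps / 8 = eps / 4 * 2^-1 by field.
  rewrite [(_ * 2^-1) ^+ _]exprMn -[X in X <= _]mulrA -[X in _ * X <= _]exprMn.
  have e40 : 0 <= eps / 4 by lra.
  have hb0 : 0 <= 2^-1 * (b - xi) by rewrite mulr_ge0.
  apply: ler_pM; rewrite ?exprn_ge0 //.
    by rewrite exprS ler_piMr // exprn_ile1 //; lra.
  by rewrite lerXn2r ?nnegrE ?subr_ge0 // mulrC.
have uv : u < v.
  rewrite lt_neqAle (le_trans uxi xiv) andbT; apply/eqP => uv; lra.
have wu w : K w -> w < v -> w <= u.
  move=> Kw wv; apply: umax => //; rewrite leNgt; apply/negP => t0w.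
  by have := vmin _ Kw (ltW t0w); rewrite leNgt wv.
have vw w : K w -> u < w -> v <= w.
  by move=> Kw tw; rewrite leNgt; apply/negP => /(wu _ Kw); rewrite leNgt tw.
pose t1 := Num.max xi (v - eps / 2 * (v - u)).
have e2' : 0 < eps / 2 * (v - u) by rewrite mulr_gt0 ?subr_gt0 ?divr_gt0.
have xt1 : xi <= t1 by rewrite le_max lexx.
have t1v : t1 <= v by rewrite ge_max xiv /=; lra.
have et1 : eps / 2 * (v - xi) <= v - t1.
  have i1 : eps / 2 * (v - xi) <= v - xi by rewrite ler_piMl ?subr_ge0 //; lra.
  have i2 : eps / 2 * (v - xi) <= eps / 2 * (v - u) by rewrite ler_wpM2l //; lra.
  by rewrite lerBrDr -lerBrDl ge_max; apply/andP; split; lra.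
have It1 : I t1 by apply: (iI Ixi (KI Kv)); rewrite xt1.
have i1 : m * ((b - t1) ^+ n.+1 - (b - v) ^+ n.+1) <= G v - G t1.
  apply: increment_ge => // w /andP[tw wv]; apply: (@gap_right u v) => //.
  by apply: le_trans tw; rewrite le_max lexx orbT.
have i2 := increment_ge0 Ixi xt1 (le_trans t1v vb).
have i3 : (v - t1) ^+ n.+1 <= (b - t1) ^+ n.+1 - (b - v) ^+ n.+1.
  have := @exprD_superadd _ (v - t1) (b - v) n.
  rewrite !subr_ge0 => /(_ t1v vb).
  have -> : v - t1 + (b - v) = b - t1 by ring.
  lra.
have i4 : (eps / 8 * (b - xi)) ^+ n.+1 <= (v - t1) ^+ n.+1.
  have vt1 : 0 <= v - t1 by rewrite subr_ge0.
  rewrite lerXn2r ?nnegrE ?(mulr_ge0 e80 bx0) //.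
  apply: le_trans et1.
  have -> : eps / 8 * (b - xi) = eps / 2 * ((b - xi) / 4) by field.
  by rewrite ler_wpM2l //; lra.
have i5 := ler_wpM2l m0 (le_trans i4 i3).
rewrite mulrAC -exprMn mulrC; lra.
Qed.

End growth.

(** * Lower bound for divided differences and the analytic estimate *)

Section main_bound.
Variables (R : realType) (I K : set R) (eps : R).
Hypotheses (iI : is_interval I) (cK : closed K) (KI : K `<=` I).
Hypotheses (eps0 : 0 < eps) (eps1 : eps < 1).

(* Rolle's theorem for [h k t - Q^(k)(t)] along [taylor_quot], with [b] the largest
   node, gives [xi] such that [(b - xi)^(n+1)] times the divided difference is
   the integral over [[xi, b]] of [h n.+1] against a decreasing weight. Unlike the
   mean value form, this sees [h n.+1] on all of [K_eps] between [xi] and [b]. *)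
Lemma divdiff_lower (n : nat) (h : nat -> R -> R) (m : R) (x : nat -> R) :
  derivs I n.+1 h -> 0 <= m ->
  (forall t, I t -> 0 <= h n.+1 t) \/ (forall t, I t -> h n.+1 t <= 0) ->
  (forall t, K_eps I K eps t -> m <= `|h n.+1 t|) ->
  (forall i, (i < n.+2)%N -> K (x i)) ->
  (forall i j, (i < n.+2)%N -> (j < n.+2)%N -> x i = x j -> i = j) ->
  (eps / 8) ^+ n.+1 * m <= n.+1`!%:R * `|divdiff x (h 0%N) n.+1|.
Proof.
move=> hD m0 hs hm Kx xinj.
have [sg [sg1 hsg]] : exists sg : R, `|sg| = 1 /\
    forall t, I t -> sg * h n.+1 t = `|h n.+1 t|.
  case: hs => hs; [exists 1|exists (-1)]; rewrite ?normrN normr1; split => // t /hs.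
    by move=> ht; rewrite mul1r ger0_norm.
  by move=> ht; rewrite mulN1r ler0_norm.
set Q := interp x (h 0%N) n.+2.
set kap := divdiff x (h 0%N) n.+1.
have Qx i : (i < n.+2)%N -> Q.[x i] = h 0%N (x i).
  by move=> ik; rewrite /Q (interp_node xinj).
pose hh k t := h k t - Q^`(k).[t].
have hhD : derivs I n.+1 hh := derivsB hD (derivs_horner (n := n.+1) Q).
have hhx i : (i < n.+2)%N -> hh 0%N (x i) = 0.
  by move=> ik; rewrite /hh derivn0 Qx // subrr.
have hhn t : hh n.+1 t = h n.+1 t - n.+1`!%:R * kap.
  by rewrite /hh derivn_size ?size_interp // coef_interp.
have [ib _ ibP] := @arg_maxP _ _ 'I_n.+2 ord0 predT (fun i => x i) isT.
have [iu _ iuP] := @arg_minP _ _ 'I_n.+2 ord0 predT (fun i => x i) isT.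
set b := x ib in ibP; set u0 := x iu in iuP.
have xb i : (i < n.+2)%N -> x i <= b.
  by move=> ik; apply: (ibP (Ordinal ik)).
have xu i : (i < n.+2)%N -> u0 <= x i.
  by move=> ik; apply: (iuP (Ordinal ik)).
have Kb : K b by apply: Kx.
have Ku0 : K u0 by apply: Kx.
(* The end [b] is excluded, since [taylor_quot] divides by [b - t]. *)
pose D := [set t | [/\ I t, u0 <= t & t < b]].
have iD : is_interval D.
  move=> s t [Is us sb] [It ut tb] w /andP[sw wt]; split.
  - by apply: (iI Is It); rewrite sw.
  - exact: le_trans sw.
  - exact: le_lt_trans tb.
have bs : b \in mkseq x n.+2.
  by apply/mapP; exists (ib : nat) => //; rewrite mem_iota /=.
have us := nodes_uniq xinj.
(* The [n + 1] nodes other than [b] are zeros of [taylor_quot hh b 1 = hh 0 / (b - .)];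
   differentiating [n] times leaves a zero of [taylor_quot hh b n.+1]. *)
have [|||||xi [Ixi uxi xib]] := @Rolle_iter _ D n (fun k => taylor_quot hh b k.+1)
   (fun k => k.+1%:R) (rem b (mkseq x n.+2)) iD.
- by move=> k _; rewrite pnatr_eq0.
- move=> k kn t [It ut tb].
  by apply: (is_derive_taylor_quot hhD It tb); apply: ltnW.
- exact: rem_uniq.
- by rewrite size_rem // size_mkseq.
- move=> t; rewrite (rem_filter _ us) mem_filter /= => /andP[tb /mapP[i + e]].
  rewrite mem_iota => /andP[_ ik]; rewrite e in tb *; split.
    split; [exact: KI (Kx _ ik)|exact: xu|].
    by rewrite lt_neqAle tb xb.
  by rewrite hhx // mul0r add0r mul0r.
move=> /= q0.
have T0 : taylor_sum hh b n.+1 xi = 0.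
  by rewrite taylor_sum_quot // [taylor_quot _ _ _ _]q0 mul0r.
have Tb : taylor_sum hh b n.+1 b = 0 by rewrite taylor_sum_end hhx.
have nf : n`!%:R != 0 :> R by rewrite pnatr_eq0 -lt0n fact_gt0.
(* The second term cancels the contribution of [kap] to [hh n.+1], so [G] is a weighted primitive of
   [|h n.+1|]. The Taylor sum vanishes at [xi] and at [b], hence [G b - G xi] is
   [sg (n+1)! kap (b - xi)^(n+1)]. *)
pose G t := sg * n.+1`!%:R * taylor_sum hh b n.+1 t - sg * n.+1`!%:R * kap * (b - t) ^+ n.+1.
have GD t : I t -> is_derive t 1 G (`|h n.+1 t| * (n.+1%:R * (b - t) ^+ n)).
  move=> It.
  have D1 := is_derive_mulr (sg * n.+1`!%:R) (is_derive_taylor_sum b hhD It (ltnSn n)).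
  have D2 := is_derive_mulr (sg * n.+1`!%:R * kap) (is_derive_subl_pow t b n.+1).
  have := is_deriveB D1 D2.
  rewrite -hsg // hhn.
  congr is_derive.
    by apply/funext => u; rewrite /G -[LHS]/(_ - _); congr (_ - _); rewrite mulrC.
  by rewrite factS natrM /=; field.
have bxi : 0 < b - xi by rewrite subr_gt0.
have key : (eps / 8) ^+ n.+1 * m * (b - xi) ^+ n.+1 <= G b - G xi.
  by apply: (@growth _ I K _ _ _ (fun t => `|h n.+1 t|)) GD _ _ Ku0 uxi xib.
have {}key : (eps / 8) ^+ n.+1 * m <= sg * (n.+1`!%:R * kap).
  rewrite -(ler_pM2r (exprn_gt0 n.+1 bxi)); apply: (le_trans key).
  rewrite /G T0 Tb subrr expr0n mulr0 !mulr0; lra.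
apply: (le_trans key); apply: (le_trans (ler_norm _)).
by rewrite normrM sg1 mul1r normrM normr_nat.
Qed.

End main_bound.

(** The analytic half, with the measure abstracted away: [lam] bounds the values at the nodes and
    [beta k] stands for [L_(k+1)(I')]. The Newton form controls the interpolation polynomial,
    [divdiff_lower] the remainder, and [landau_kolmogorov] passes to derivatives. *)
Lemma derivative_bound (R : realType) (n : nat) (eps B : R) : (0 < n)%N ->
  0 < eps -> eps < 1 -> 0 < B ->
  exists2 c : R, 0 < c &
    forall (I K : set R) (h : nat -> R -> R) (m C lam a b : R) (x beta : nat -> R),
    is_interval I -> closed K -> K `<=` I ->
    derivs I n h -> 0 <= m -> 1 <= C ->
    (forall t, I t -> 0 <= h n t) \/ (forall t, I t -> h n t <= 0) ->
    (forall t, K_eps I K eps t -> m <= `|h n t|) ->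
    (forall t, I t -> `|h n t| <= C * m) ->
    a < b -> `[a, b] `<=` I ->
    (forall i, (i < n.+1)%N -> K (x i)) ->
    (forall i j, (i < n.+1)%N -> (j < n.+1)%N -> x i = x j -> i = j) ->
    (forall i, (i < n.+1)%N -> `|h 0%N (x i)| <= lam) ->
    (forall k, (k < n)%N -> b - a <= beta k) ->
    (forall k t, (k < n)%N -> `[a, b]%classic t -> `|t - x k| <= beta k) ->
    (forall k i, (k <= n)%N -> (i <= k)%N ->
       B * \prod_(l < k) beta l <= `|node_prod x k.+1 i|) ->
    forall j t, (j <= n)%N -> `[a, b]%classic t ->
      `|h j t| * (b - a) ^+ j <= c * C * lam.
Proof.
move=> n0 e0 e1 B0; have [cLK c1 LK] := landau_kolmogorov R n0.
have e8 : 0 < (eps / 8) ^+ n by rewrite exprn_gt0 // divr_gt0.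
(* [E1 * lam] will bound the interpolation polynomial on [[a, b]], and [E2 * lam] the product of [m]
   and all [beta l]. *)
pose E1 : R := n%:R * n%:R / B.
pose E2 : R := n`!%:R * (n.+1%:R / B) / (eps / 8) ^+ n.
have E10 : 0 <= E1 by rewrite divr_ge0 ?mulr_ge0 // ltW.
have E20 : 0 < E2.
  by rewrite divr_gt0 // mulr_gt0 ?divr_gt0 ?ltr0n ?fact_gt0.
exists (cLK * (E1 + E2)).
  by rewrite mulr_gt0 ?(lt_le_trans ltr01 c1) ?ltr_wpDl.
move=> I K h m C lam a b x beta iI cK KI hD m0 C1 hs hm hM ab abI Kx xinj hx bab xbeta xprod.
have lam0 : 0 <= lam by apply: le_trans (hx 0%N isT).
have ba0 : 0 < b - a by rewrite subr_gt0.
have beta0 k : (k < n)%N -> 0 < beta k by move=> kn; apply: lt_le_trans (bab _ kn).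
have P0 k : (k <= n)%N -> 0 < \prod_(l < k) beta l.
  by move=> kn; apply: prodr_gt0 => l _; apply: beta0; apply: leq_trans kn.
have dd k : (k <= n)%N ->
    `|divdiff x (h 0%N) k| * \prod_(l < k) beta l <= k.+1%:R / B * lam.
  move=> kn; rewrite -ler_pdivlMr ?P0 //.
  have -> : k.+1%:R / B * lam / \prod_(l < k) beta l =
      k.+1%:R * lam / (B * \prod_(l < k) beta l).
    by field; rewrite !gt_eqF // P0.
  apply: divdiff_bound; first by rewrite mulr_gt0 ?P0.
    by move=> i ik; apply: hx; exact: (leq_ltn_trans ik).
  by move=> i ik; apply: xprod.
have node k t : (k <= n)%N -> `[a, b]%classic t ->
    `|(node_poly x k).[t]| <= \prod_(l < k) beta l.
  move=> kn tab; rewrite horner_prod normr_prod; apply: ler_prod => l _.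
  by rewrite normr_ge0 hornerXsubC xbeta // (leq_trans _ kn).
have mP : m * \prod_(l < n) beta l <= E2 * lam.
  have : (eps / 8) ^+ n * m <= n`!%:R * `|divdiff x (h 0%N) n|.
    by case: n n0 {LK e8 E1 E2 E10 E20 dd node P0 beta0 hx bab xbeta xprod hM} hD hs hm Kx xinj => // n _ *; apply: (divdiff_lower iI cK KI e0 e1).
  move=> /(ler_wpM2r (ltW (P0 n (leqnn n)))).
  rewrite -[X in _ <= X]mulrA.
  move=> /le_trans /(_ (ler_wpM2l (ler0n R n`!) (dd n (leqnn n)))) key.
  rewrite /E2 mulrAC ler_pdivlMr // [X in X <= _]mulrC [X in X <= _]mulrA.
  by apply: (le_trans key); rewrite le_eqVlt; apply/orP; left; apply/eqP; ring.
have CP : C * m * \prod_(l < n) beta l <= E2 * (C * lam).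
  by rewrite -[X in X <= _]mulrA [X in _ <= X]mulrCA ler_wpM2l // (le_trans ler01 C1).
have CE1 : E1 * lam <= E1 * (C * lam).
  by rewrite ler_wpM2l // ler_peMl.
have CE10 : 0 <= E1 * (C * lam).
  exact: mulr_ge0 E10 (mulr_ge0 (le_trans ler01 C1) lam0).
move=> j t jn tab.
have -> : cLK * (E1 + E2) * C * lam = cLK * ((E1 + E2) * (C * lam)) by ring.
apply: (LK a b _ h ab) => //.
- by move=> k kn u uab; apply: hD => //; apply: abI.
- move=> u uab.
  have iab := @interval_is_interval R `[a, b].
  have err : `|h 0%N u - (interp x (h 0%N) n).[u]| <= C * m * `|(node_poly x n).[u]|.
    apply: (interp_error iI hD) => //.
    - by move=> i k ik kn; apply: xinj; apply: ltnW.
    - by move=> i ik; apply: KI; apply: Kx; apply: ltnW.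
    - exact: abI.
  have pb : `|(interp x (h 0%N) n).[u]| <= E1 * lam.
    rewrite (@interp_newton_sum _ x n.+1) // horner_sum.
    apply: (le_trans (ler_norm_sum _ _ _)).
    have -> : E1 * lam = \sum_(k < n) (n%:R / B * lam).
      by rewrite sumr_const card_ord /E1 -mulr_natr; field; rewrite gt_eqF.
    apply: ler_sum => k _; rewrite hornerZ normrM.
    have kn : (k <= n)%N by apply: ltnW.
    apply: (le_trans (ler_wpM2l (normr_ge0 _) (node k u kn uab))).
    apply: (le_trans (dd k kn)); rewrite ler_wpM2r // ler_wpM2r ?invr_ge0 ?(ltW B0) //.
    by rewrite ler_nat.
  rewrite -[h 0%N u](subrK (interp x (h 0%N) n).[u]).
  apply: (le_trans (ler_normD _ _)).
  have : C * m * `|(node_poly x n).[u]| <= E2 * (C * lam).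
    by apply: le_trans CP; rewrite ler_wpM2l ?node // mulr_ge0 // (le_trans ler01).
  lra.
- move=> u uab.
  have : `|h n u| * (b - a) ^+ n <= C * m * \prod_(l < n) beta l.
    apply: ler_pM; rewrite ?exprn_ge0 ?(ltW ba0) ?hM //; first exact: abI.
    have -> : (b - a) ^+ n = \prod_(l < n) (b - a) by rewrite prodr_const card_ord.
    by apply: ler_prod => l _; rewrite (ltW ba0) bab.
  lra.
Qed.

(** * Finite extrema, distinct representatives and arithmetic progressions *)

Section finite_choices.

Lemma seq_argmax d (T : orderType d) (f : nat -> T) (s : seq nat) : s != [::] ->
  exists2 l, l \in s & forall k, k \in s -> (f k <= f l)%O.
Proof.
elim: s => // l [|l' s] IH _.
  by exists l; rewrite ?mem_head // => k; rewrite inE => /eqP ->.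
have [//|m ms mmax] := IH.
have [lm|ml] := leP (f l) (f m).
  exists m; first by rewrite inE ms orbT.
  by move=> k; rewrite inE => /predU1P[->|/mmax].
exists l; first by rewrite mem_head.
by move=> k; rewrite inE => /predU1P[->//|/mmax km]; apply: le_trans km (ltW ml).
Qed.

Lemma seq_argmin d (T : orderType d) (f : nat -> T) (s : seq nat) : s != [::] ->
  exists2 l, l \in s & forall k, k \in s -> (f l <= f k)%O.
Proof. exact: (@seq_argmax _ (T^d)%type). Qed.

Lemma fresh_nat (l : seq nat) (m : nat) : (size l < m)%N ->
  exists2 s, (s < m)%N & s \notin l.
Proof.
move=> lm; apply/not_exists2P => H.
have : {subset iota 0 m <= l}.
  move=> s; rewrite mem_iota /= add0n => sm; apply/negPn/negP => sl.
  by case: (H s).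
by move=> /(uniq_leq_size (iota_uniq 0 m)); rewrite size_iota leqNgt lm.
Qed.

(** The easy case of Hall's theorem: when index [k] is served, [k] values are taken and [k + 1] are
    available. *)
Lemma greedy_representatives (P : nat -> pred nat) (m : nat) :
  (forall k, (k < m)%N -> exists l, [/\ uniq l, size l = k.+1 & all (P k) l]) ->
  exists us, [/\ uniq us, size us = m & forall k, (k < m)%N -> P k (nth 0%N us k)].
Proof.
elim: m => [|m IH] HP; first by exists [::].
have [|us [uus sus Pus]] := IH; first by move=> k km; apply: HP; apply: ltnW.
have [l [ul sl Pl]] := HP m (ltnSn m).
have [u ul' uus'] : exists2 u, u \in l & u \notin us.
  apply/not_exists2P => H.
  have : {subset l <= us}.
    by move=> u ul'; apply/negPn/negP => uus'; case: (H u).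
  by move=> /(uniq_leq_size ul); rewrite sl sus ltnn.
exists (rcons us u); split; first by rewrite rcons_uniq uus'.
  by rewrite size_rcons sus.
move=> k; rewrite ltnS leq_eqVlt nth_rcons sus => /predU1P[->|km].
  by rewrite ltnn eqxx (allP Pl).
by rewrite km Pus.
Qed.

Lemma range_ge_size (s : seq nat) (lo hi : nat) : uniq s ->
  (forall u, u \in s -> lo <= u <= hi)%N -> (size s <= hi.+1 - lo)%N.
Proof.
move=> us H; rewrite -[X in (_ <= X)%N](size_iota lo); apply: uniq_leq_size => // u /H.
rewrite mem_iota; lia.
Qed.

End finite_choices.

(* The offset [s] of the arithmetic progression [s + v (r+1)] can be chosen so
   that no window of [k r] consecutive slots contains fewer than [k] terms: each
   window excludes at most [k] residues of [s]. *)
Lemma lattice_offset (n r : nat) (a : nat -> nat) : (n * n + n <= r)%N ->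
  exists2 s, (s <= n * n)%N & forall k, (k < n)%N ->
    exists v, (a k <= s + v * r.+1 <= a k + (r - k.+1))%N.
Proof.
move=> nr.
(* These [n * n] residues include every offset [s] that fails for some [k]. *)
pose l := [seq ((a k + r - k + j) %% r.+1)%N | k <- iota 0 n, j <- iota 0 n].
have [|s sn sl] := @fresh_nat l (n * n).+1.
  by rewrite size_allpairs !size_iota.
exists s => // k kn.
set q := (a k + (r - k.+1) - s)%N.
(* This gives the last term up to [a k + (r - k.+1)]. It falls short of [a k] only if the remainder
   exceeds [r - k.+1], and then [s] is on the list [l]. *)
exists (q %/ r.+1)%N.
have qE := divn_eq q r.+1.
have qm : (q %% r.+1 <= r)%N by rewrite -ltnS ltn_mod.
have sq : (s <= a k + (r - k.+1))%N by lia.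
have [h|h] := leqP (q %% r.+1) (r - k.+1); first by rewrite /q in qE h qm *; lia.
case/negP: sl; apply/allpairsP.
exists (k, (r - q %% r.+1)%N); split => /=; rewrite ?mem_iota //; first lia.
have -> : (a k + r - k + (r - q %% r.+1) = (q %/ r.+1).+1 * r.+1 + s)%N.
  rewrite mulSn; rewrite {3}/q in qE *; lia.
by rewrite modnMDl modn_small //; lia.
Qed.

(** * Windows of slots and the choice of nodes *)

Section windows.
Variables (R : realFieldType) (z : nat -> R) (n r : nat).
Hypothesis z_nd : forall i j, (i <= j)%N -> z i <= z j.

(** Large enough for all positions [s + v * (r + 1)] with [s <= n^2] and [v <= n] to be numbers of
    slots. *)
Definition slots : nat := (n * r.+1 + (n * n).+1)%N.

(** A window is the pair of its end indices, in ordinals so that [best_window] minimises over a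
    finite type. The index [al] stands for the window [J] from [al] to [al + r], and
    [best_length p al] is [L_p(J)]. *)
Definition admissible (p al : nat) (w : 'I_slots.+1 * 'I_slots.+1) : bool :=
  [&& w.1 <= al, al + r <= w.2 & w.1 + p * r <= w.2]%N.

Definition window_length (w : 'I_slots.+1 * 'I_slots.+1) : R := z w.2 - z w.1.

Definition best_window (p al : nat) : 'I_slots.+1 * 'I_slots.+1 :=
  [arg min_(w < (ord0, ord_max) | admissible p al w) window_length w]%O.

Definition best_length (p al : nat) : R := window_length (best_window p al).

Lemma best_windowP (p al : nat) : (p <= n)%N -> (al + r <= slots)%N ->
  admissible p al (best_window p al) /\
  forall a e : nat, (a <= al)%N -> (al + r <= e)%N -> (a + p * r <= e)%N -> (e <= slots)%N ->
    best_length p al <= z e - z a.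
Proof.
move=> pn als; rewrite /best_length /best_window; case: arg_minP => [|w adm wmin].
  rewrite /admissible /= als andTb add0n (@leq_trans (n * r)) ?leq_mul2r ?pn ?orbT //.
  by rewrite /slots; lia.
split => // a e aal ale ape es.
have as' : (a < slots.+1)%N by lia.
have es' : (e < slots.+1)%N by lia.
apply: (wmin (Ordinal as', Ordinal es')).
by rewrite /admissible /= aal ale ape.
Qed.

Lemma best_length_ge (p al : nat) : (p <= n)%N -> (al + r <= slots)%N ->
  z (al + r)%N - z al <= best_length p al.
Proof.
move=> pn als; have [/and3P[h1 h2 h3] _] := best_windowP pn als.
by rewrite /best_length /window_length lerB // z_nd.
Qed.

Lemma best_length_mono (p q al : nat) : (p <= q)%N -> (q <= n)%N -> (al + r <= slots)%N ->
  best_length p al <= best_length q al.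
Proof.
move=> pq qn als; have [/and3P[h1 h2 h3] _] := best_windowP qn als.
have [_] := best_windowP (leq_trans pq qn) als; apply => //.
- by apply: leq_trans h3; rewrite leq_add2l leq_mul2r pq orbT.
- by rewrite -ltnS.
Qed.


Section lattice_points.
Variables (s : nat) (u : nat -> nat) (y : nat -> R) (N : nat).
Hypothesis sn : (s <= n * n)%N.
Hypothesis un : forall l, (l < N)%N -> (u l <= n)%N.
Hypothesis uinj : forall l m, (l < N)%N -> (m < N)%N -> u l = u m -> l = m.

Let idx (l : nat) : nat := (s + u l * r.+1)%N.

Hypothesis yidx : forall l, (l < N)%N -> z (idx l) <= y l <= z (idx l).+1.

Lemma idx_slots (l : nat) : (l < N)%N -> (idx l < slots)%N.
Proof.
move=> /un ul; have : (u l * r.+1 <= n * r.+1)%N by rewrite leq_mul2r ul orbT.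
rewrite /idx /slots; lia.
Qed.

Lemma idx_lt (l m : nat) : (u l < u m)%N -> (idx l + r.+1 <= idx m)%N.
Proof.
move=> lm; have : ((u l).+1 * r.+1 <= u m * r.+1)%N by rewrite leq_mul2r lm orbT.
rewrite /idx; lia.
Qed.

(** The [k + 1] points occupy distinct terms of a progression of step [r + 1], so at least [k * r]
    slots lie strictly between the extreme ones. These slots form an admissible window around [c],
    enclosed by two points within [d] of [y t]. *)
Lemma hull_length (t c k : nat) (T : seq nat) (d : R) : (0 < k)%N -> (k <= n)%N ->
  uniq (t :: T) -> size T = k -> (forall l, l \in t :: T -> (l < N)%N) ->
  (exists2 l, l \in t :: T & (idx l < c)%N) ->
  (exists2 l, l \in t :: T & (c + r <= idx l)%N) ->
  (forall l, l \in T -> `|y t - y l| <= d) ->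
  best_length k c <= 2 * d.
Proof.
move=> k0 kn uT sT TN [l1 l1T l1c] [l2 l2T l2c] Td.
have d0 : 0 <= d.
  by case: T sT Td {uT TN l1T l2T} k0 => [<- //|l T] _ Td _; apply: le_trans (Td l (mem_head _ _)).
have [//|lo loT lomin] := @seq_argmin _ _ u (t :: T).
have [//|hi hiT himax] := @seq_argmax _ _ u (t :: T).
have {}lomin l : l \in t :: T -> (u lo <= u l)%N := lomin l.
have {}himax l : l \in t :: T -> (u l <= u hi)%N := himax l.
have cs : (c + r <= slots)%N by apply: (leq_trans l2c); apply/ltnW/idx_slots/TN.
have uq : uniq (map u (t :: T)).
  by rewrite map_inj_in_uniq // => l m lT mT; apply: uinj; apply: TN.
have lohi : (k.+1 <= (u hi).+1 - u lo)%N.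
  rewrite -sT -[(size T).+1]/(size (t :: T)) -(size_map u).
  by apply: range_ge_size => // _ /mapP[l lT ->]; rewrite lomin ?himax.
have lolo := lomin _ l1T; have hihi := himax _ l2T.
have h1 : (idx lo < c)%N.
  by apply: leq_ltn_trans l1c; rewrite /idx leq_add2l leq_mul2r lolo orbT.
have h2 : (c + r <= idx hi)%N.
  by apply: (leq_trans l2c); rewrite /idx leq_add2l leq_mul2r hihi orbT.
have h3 : ((idx lo).+1 + k * r <= idx hi)%N.
  have : ((u lo + k) * r.+1 <= u hi * r.+1)%N by rewrite leq_mul2r; lia.
  by rewrite /idx mulnDl mulnS; lia.
have [_ /(_ (idx lo).+1 (idx hi) h1 h2 h3 _)] := best_windowP kn cs.
move=> /(_ (ltnW (idx_slots (TN _ hiT)))) /le_trans; apply.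
have Td' l : l \in t :: T -> `|y t - y l| <= d.
  by rewrite inE => /predU1P[->|/Td //]; rewrite subrr normr0.
have := Td' _ loT; have := Td' _ hiT; rewrite !ler_norml.
have /andP[_] := yidx (TN _ loT); have /andP[+ _] := yidx (TN _ hiT).
lra.
Qed.

(* Removing the point farthest from [y t] and inducting keeps the window [c],
   placed next to [y t] on the side of its last remaining neighbour, inside
   every intermediate hull. *)
Lemma adjacent_window (t k : nat) (T : seq nat) : (0 < k)%N -> (k <= n)%N ->
  uniq (t :: T) -> size T = k -> (forall l, l \in t :: T -> (l < N)%N) ->
  exists c, [/\ exists2 l, l \in t :: T & (idx l < c)%N,
    exists2 l, l \in t :: T & (c + r <= idx l)%N &
    \prod_(0 <= p < k) best_length p.+1 c <= 2 ^+ k * \prod_(l <- T) `|y t - y l|].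
Proof.
elim: k T => // k IH T _ kn uT sT TN.
have T0 : T != [::] by case: T sT {uT TN}.
have [m mT mmax] := seq_argmax (fun l => `|y t - y l|) T0.
have pT := perm_to_rem mT.
move: (uT) => /=; rewrite (perm_mem pT) (perm_uniq pT) /= inE negb_or => /and3P[/andP[tm trem] mrem urem].
have srem : size (rem m T) = k by rewrite size_rem // sT.
have [c [[l1 l1T l1c] [l2 l2T l2c] cprod]] : exists c,
    [/\ exists2 l, l \in t :: T & (idx l < c)%N,
    exists2 l, l \in t :: T & (c + r <= idx l)%N &
    \prod_(0 <= p < k) best_length p.+1 c <= 2 ^+ k * \prod_(l <- rem m T) `|y t - y l|].
  have mtT : m \in t :: T by rewrite inE mT orbT.
  case: k IH srem kn sT => [_ /size0nil -> _ _|k IH srem kn sT].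
    have : u t != u m.
      by apply: contra_neq tm => /uinj; apply; apply: TN => //; rewrite mem_head.
    (* With two points left, [c] comes right after the slot of the left one; the step [r + 1] leaves
       [r] slots before the other. *)
    rewrite neq_ltn => /orP[] /idx_lt h.
      exists (idx t).+1; split; [exists t; rewrite ?mem_head //|exists m => //; lia|].
      by rewrite big_geq // big_nil mulr1.
    exists (idx m).+1; split; [exists m => //|exists t; rewrite ?mem_head //; lia|].
    by rewrite big_geq // big_nil mulr1.
  have sub l : l \in t :: rem m T -> l \in t :: T.
    by rewrite !inE => /predU1P[->|/mem_rem ->]; rewrite ?eqxx ?orbT.
  have [|||c [[l1 l1T l1c] [l2 l2T l2c] cprod]] := IH (rem m T) isT (ltnW kn).
  - by rewrite /= trem.
  - exact: srem.
  - by move=> l /sub; apply: TN.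
  by exists c; split => //; [exists l1|exists l2] => //; apply: sub.
exists c; split; [by exists l1|by exists l2|].
have cs : (c + r <= slots)%N by apply: (leq_trans l2c); apply/ltnW/idx_slots/TN.
rewrite big_nat_recr //= (perm_big _ pT) /= big_cons.
have -> : 2 ^+ k.+1 * (`|y t - y m| * \prod_(j <- rem m T) `|y t - y j|) =
  (2 ^+ k * \prod_(j <- rem m T) `|y t - y j|) * (2 * `|y t - y m|).
  by rewrite exprS; ring.
have b0 p : (p < n)%N -> 0 <= best_length p.+1 c.
  move=> pn; apply: le_trans (best_length_ge pn cs).
  by rewrite subr_ge0 z_nd // leq_addr.
apply: ler_pM => //.
- by rewrite big_mkord; apply: prodr_ge0 => p _; apply: b0; apply: ltn_trans kn.
- exact: b0.
(* The removed point [m] pays for the new factor, since all of [T] is within [|y t - y m|] of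
   [y t]. *)
- by apply: (@hull_length t c k.+1 T) => //; [exists l1|exists l2].
Qed.

End lattice_points.

(** The combinatorial half: for a nondegenerate [I'] it supplies what [derivative_bound] asks of
    nodes and lengths, whichever points [y k] are picked in the slots [idx k]. *)
Lemma selection : (0 < n)%N -> (n * n + n <= r)%N ->
  exists (al : nat) (idx : nat -> nat) (beta : nat -> R),
  [/\ (al + r <= slots)%N, forall k, (k <= n)%N -> (idx k < slots)%N &
    z al < z (al + r)%N ->
    forall y, (forall k, (k <= n)%N -> z (idx k) <= y k <= z (idx k).+1) ->
    [/\ forall k, (k < n)%N -> z (al + r)%N - z al <= beta k,
      forall k t, (k < n)%N -> z al <= t <= z (al + r)%N -> `|t - y k| <= beta k,
      forall k i, (k <= n)%N -> (i <= k)%N ->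
        (2 ^+ n)^-1 * \prod_(l < k) beta l <= `|node_prod y k.+1 i| &
      forall i j, (i < n.+1)%N -> (j < n.+1)%N -> y i = y j -> i = j]].
Proof.
move=> n0 nr.
have rs : (r <= slots)%N.
  by rewrite (leq_trans (leqnSn r)) // (leq_trans (leq_pmull r.+1 n0)) // /slots leq_addr.
pose W c := \prod_(0 <= p < n) best_length p.+1 c.
have [al' _ alP] := @arg_minP _ _ 'I_(slots - r).+1 ord0 predT (fun c => W c) isT.
pose al := (al' : nat).
have als : (al + r <= slots)%N by rewrite /al; have := ltn_ord al'; lia.
have {alP}Wmin c : (c + r <= slots)%N -> W al <= W c.
  move=> cs; have c' : (c < (slots - r).+1)%N by lia.
  exact: (alP (Ordinal c') isT).
pose a k := nat_of_ord (best_window k.+1 al).1.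
pose e k := nat_of_ord (best_window k.+1 al).2.
have win k : (k < n)%N -> [/\ (a k <= al)%N, (al + r <= e k)%N & (a k + k.+1 * r <= e k)%N].
  by move=> kn; have [/and3P[]] := best_windowP kn als.
have es k : (e k <= slots)%N by have := ltn_ord (best_window k.+1 al).2.
pose beta k := best_length k.+1 al.
have betaE k : beta k = z (e k) - z (a k) by [].
have [s sn sP] := lattice_offset a nr.
(* Node [k < n] must lie in the optimal window of order [k + 1]; the last node may be in any slot of
   the progression. *)
pose P k : pred nat := fun v => (v <= n)%N &&
  ((k < n)%N ==> (a k <= s + v * r.+1)%N && (s + v * r.+1 < e k)%N).
have [|us [uus sus usP]] := @greedy_representatives P n.+1.
  move=> k; rewrite ltnS leq_eqVlt => /predU1P[->|kn].
    exists (iota 0 n.+1); split; rewrite ?iota_uniq ?size_iota //.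
    by apply/allP => v; rewrite mem_iota /P ltnn implyFb andbT.
  have [v /andP[v1 v2]] := sP k kn; have [w1 w2 w3] := win k kn.
  (* As the first term is at most [r - k.+1] slots after [a k], [k + 1] consecutive terms fit into
     [k.+1 * r] slots. *)
  exists (iota v k.+1); split; rewrite ?iota_uniq ?size_iota //.
  apply/allP => x; rewrite mem_iota => /andP[vx xv].
  have [j jk xE] : exists2 j, (j <= k)%N & x = (v + j)%N.
    by exists (x - v)%N; lia.
  have jr : (j * r.+1 <= k * r + k)%N.
    by rewrite addnC -mulnS leq_mul2r jk orbT.
  have xe : (s + x * r.+1 < e k)%N.
    by rewrite xE mulnDl; rewrite mulSn in w3; lia.
  rewrite /P kn xe andbT /=; apply/andP; split.
    rewrite -ltnS -(@ltn_pmul2r r.+1) // mulSn.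
    have := es k; rewrite /slots; lia.
  by apply: (leq_trans v1); rewrite leq_add2l leq_mul2r xE leq_addr orbT.
pose u k := nth 0%N us k.
pose idx k := (s + u k * r.+1)%N.
have un l : (l < n.+1)%N -> (u l <= n)%N by move=> /usP /andP[].
have uinj l m : (l < n.+1)%N -> (m < n.+1)%N -> u l = u m -> l = m.
  by move=> ln mn /eqP; rewrite nth_uniq ?sus // => /eqP.
have uwin k : (k < n)%N -> (a k <= idx k)%N /\ (idx k < e k)%N.
  by move=> kn; have /usP /andP[_] := ltnW kn : (k < n.+1)%N; rewrite kn => /andP.
exists al, idx, beta; split => //.
  by move=> k kn; apply: (@idx_slots s u n.+1 sn un).
move=> zal y yidx.
have J0 : 0 < z (al + r)%N - z al by rewrite subr_gt0.
have bJ k : (k < n)%N -> z (al + r)%N - z al <= beta k.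
  by move=> kn; apply: best_length_ge.
have b0 k : (k < n)%N -> 0 < beta k by move=> /bJ; apply: lt_le_trans.
have bmono l p : (l <= p)%N -> (p < n)%N -> beta l <= beta p.
  by move=> lp pn; apply: best_length_mono.
have P0 k : (k <= n)%N -> 0 < \prod_(0 <= l < k) beta l.
  move=> kn; rewrite big_mkord; apply: prodr_gt0 => l _; apply: b0.
  exact: leq_trans kn.
have lower k i : (k <= n)%N -> (i <= k)%N ->
    (2 ^+ n)^-1 * \prod_(l < k) beta l <= `|node_prod y k.+1 i|.
  move=> kn ik; rewrite -(big_mkord xpredT beta) ler_pdivrMl ?exprn_gt0 //.
  rewrite normr_prod -(big_mkord (fun l => l != i) (fun l => `|y i - y l|)).
  have ui := iota_uniq 0 k.+1.
  have ii : i \in iota 0 k.+1 by rewrite mem_iota.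
  have -> : \prod_(0 <= l < k.+1 | l != i) `|y i - y l| =
      \prod_(l <- rem i (iota 0 k.+1)) `|y i - y l|.
    by rewrite rem_filter // big_filter /index_iota subn0.
  set T := rem i _.
  have uT : uniq (i :: T) by rewrite /= rem_uniq // andbT mem_rem_uniq // inE eqxx.
  have sT : size T = k by rewrite size_rem // size_iota.
  have Tk l : l \in i :: T -> (l <= k)%N.
    by rewrite inE => /predU1P[->//|/mem_rem]; rewrite mem_iota.
  have TN l : l \in i :: T -> (l < n.+1)%N.
    by move=> /Tk lk; rewrite ltnS (leq_trans lk).
  have [k0|k0] := posnP k.
    rewrite k0 big_geq // (size0nil (etrans sT k0)) big_nil mulr1.
    by rewrite exprn_ege1 // ler1n.
  have [c [[l1 l1T l1c] [l2 l2T l2c] cprod]] :=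
    @adjacent_window s u y n.+1 sn un uinj yidx i k T k0 kn uT sT TN.
  have cs : (c + r <= slots)%N.
    by apply: (leq_trans l2c); apply/ltnW/(@idx_slots s u n.+1 sn un)/TN.
  (* The union of the window at [c] and the optimal one of order [p + 1] at [al] is admissible for
     [c]. Its parts on either side of [z al] have length at most [beta p], because the nodes [l1]
     and [l2] enclosing [c] lie in optimal windows of order at most [p + 1]. *)
  have rest : \prod_(k <= p < n) best_length p.+1 c <=
      2 ^+ (n - k) * \prod_(k <= p < n) beta p.
    rewrite -prodr_const_nat -big_split /= big_nat_cond [X in _ <= X]big_nat_cond.
    apply: ler_prod => p; rewrite andbT => /andP[kp pn].
    rewrite (le_trans _ (best_length_ge pn cs)) ?subr_ge0 ?z_nd ?leq_addr //=.
    have l1n : (l1 < n)%N by apply: leq_ltn_trans (leq_trans (Tk _ l1T) kp) pn.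
    have l2n : (l2 < n)%N by apply: leq_ltn_trans (leq_trans (Tk _ l2T) kp) pn.
    have [w1 w2 w3] := win p pn.
    have [w11 w12 _] := win l1 l1n; have [w21 w22 _] := win l2 l2n.
    have [u11 _] := uwin l1 l1n; have [_ u22] := uwin l2 l2n.
    have b1 := bmono _ _ (leq_trans (Tk _ l1T) kp) pn.
    have b2 := bmono _ _ (leq_trans (Tk _ l2T) kp) pn.
    rewrite -/(idx l1) in l1c; rewrite -/(idx l2) in l2c.
    have [_ /(_ (minn c (a p)) (maxn (c + r) (e p)))] := best_windowP pn cs.
    rewrite geq_minl leq_maxl geq_max cs es => /(_ isT isT) H.
    have {}H := H (leq_trans (leq_add (geq_minr c (a p)) (leqnn _)) (leq_trans w3 (leq_maxr _ _))) isT.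
    apply: (le_trans H).
    have hmin : z al - z (minn c (a p)) <= beta p.
      rewrite /minn; case: ifP => _.
        apply: le_trans b1; rewrite betaE; apply: lerB; apply: z_nd.
          exact: leq_trans (leq_addr r al) w12.
        exact: ltnW (leq_ltn_trans u11 l1c).
      rewrite betaE; apply: lerB; apply: z_nd => //.
      exact: leq_trans (leq_addr r al) w2.
    have hmax : z (maxn (c + r) (e p)) - z al <= beta p.
      rewrite /maxn; case: ifP => _.
        by rewrite betaE; apply: lerB; apply: z_nd.
      apply: le_trans b2; rewrite betaE; apply: lerB; apply: z_nd => //.
      exact: leq_trans l2c (ltnW u22).
    lra.
  (* By minimality of [W al] the factors of order above [k] cancel up to [2^(n-k)], and [cprod]
     handles the first [k]. *)
  have := Wmin c cs; rewrite /W.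
  rewrite (@big_cat_nat _ _ _ k 0 n) //= [X in _ <= X](@big_cat_nat _ _ _ k 0 n) //=.
  have A0 : 0 <= \prod_(0 <= p < k) best_length p.+1 c.
    rewrite big_mkord; apply: prodr_ge0 => p _.
    have pn : (p < n)%N by apply: leq_trans kn.
    by rewrite (le_trans _ (best_length_ge pn cs)) ?subr_ge0 ?z_nd ?leq_addr.
  have R0 : 0 < \prod_(k <= p < n) beta p.
    rewrite big_nat_cond; apply: prodr_gt0 => p; rewrite andbT => /andP[_ pn].
    exact: b0.
  move=> /le_trans /(_ (ler_wpM2l A0 rest)).
  rewrite mulrA ler_pM2r // => /le_trans; apply.
  rewrite -{2}(subnK kn) exprD -mulrA [X in X <= _]mulrC.
  by rewrite ler_wpM2l // exprn_ge0.
split => //.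
- move=> k t kn /andP[t1 t2].
  have [w1 w2 _] := win k kn; have [u1 u2] := uwin k kn.
  have /andP[y1 y2] := yidx k (ltnW kn).
  have za : z (a k) <= z (idx k) by apply: z_nd.
  have ze : z (idx k).+1 <= z (e k) by apply: z_nd.
  have zal' : z (a k) <= z al by apply: z_nd.
  have zel' : z (al + r)%N <= z (e k) by apply: z_nd.
  by rewrite betaE ler_norml; apply/andP; split; lra.
- move=> i j iN jN yij; apply/eqP/negPn/negP => ij.
  (* Equal nodes would annihilate a product that [lower] keeps positive. *)
  have := lower n i (leqnn n) iN.
  rewrite normr_prod (bigD1 (Ordinal jN)) /=; last by rewrite eq_sym.
  rewrite yij subrr normr0 mul0r leNgt; move/negP; apply.
  by rewrite mulr_gt0 ?invr_gt0 ?exprn_gt0 // -(big_mkord xpredT beta) P0.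
Qed.

End windows.

(** * Quantiles of [mu] *)

Section quantiles.
Local Open Scope classical_set_scope.
Variables (R : realType) (mu : probability (measurableTypeR R) R).

(** [cdf] takes a random variable; the identity has law [mu], so [F] is the distribution function of
    [mu]. *)
Let idTR : measurableTypeR R -> R := idfun.

#[local] HB.instance Definition _ :=
  @isMeasurableFun.Build _ _ _ _ idTR (@measurable_id _ _ setT).

Let F : R -> \bar R := cdf (idTR : {RV mu >-> R}).

(** Take the infimum of the points where [F >= p]: right continuity of [F] gives the first
    inequality, continuity of [mu] from below the second. *)
Lemma quantile_exists (p : R) : 0 < p -> p < 1 ->
  exists z : R, (p%:E <= mu `]-oo, z])%E /\ (mu `]-oo, z[ <= p%:E)%E.
Proof.
move=> p0 p1.
have Fnd x y : x <= y -> (F x <= F y)%E by apply: cdf_nondecreasing.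
pose A := [set t : R | (p%:E <= F t)%E].
have A0 : A !=set0.
  apply/set0P/negP => /eqP A0.
  have : (1 <= p%:E)%E.
    apply: (cvge_to_le (cvg_cdfy1 (idTR : {RV mu >-> R}))).
    apply: nearW => t; rewrite leNgt; apply/negP => /ltW pF.
    by have : A t by []; rewrite A0.
  by rewrite lee_fin leNgt p1.
have Alb : has_lbound A.
  apply: contrapT => nlb.
  have : (p%:E <= 0)%E.
    apply: (cvge_to_ge (cvg_cdfNy0 (idTR : {RV mu >-> R}))).
    apply: nearW => t; have [w Aw wt] : exists2 w, A w & w < t.
      apply: contrapT => H; apply: nlb; exists t => w Aw; rewrite leNgt.
      by apply/negP => wt; apply: H; exists w.
    by apply: le_trans Aw _; apply: Fnd; apply: ltW.
  by rewrite lee_fin leNgt p0.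
have hA : has_inf A by [].
exists (inf A); split.
  apply: (cvge_to_ge (@cdf_right_continuous _ _ _ _ (idTR : {RV mu >-> R}) (inf A))).
  near=> w.
  have [t At tw] : exists2 t, A t & t < w by apply: inf_lt => //; near: w; exact: nbhs_right_gt.
  by apply: le_trans At _; apply: Fnd; apply: ltW.
pose G (k : nat) : set (measurableTypeR R) := `]-oo, inf A - k.+1%:R^-1].
have GU : \bigcup_k G k = `]-oo, inf A[.
  apply/seteqP; split => [t [k _]|t]; rewrite /G /= !in_itv /=.
    by move=> /le_lt_trans; apply; rewrite ltrBlDr ltrDl invr_gt0.
  move=> tA; have := archi_boundP (ltW (_ : 0 < (inf A - t)^-1)).
  rewrite invr_gt0 subr_gt0 => /(_ tA) H.
  exists (Num.bound (inf A - t)^-1) => //=; rewrite in_itv /=.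
  rewrite lerBrDr -lerBrDl -[X in _ <= X]invrK lef_pV2 ?posrE ?invr_gt0 ?subr_gt0 //.
  by apply: ltW; apply: (lt_trans H); rewrite ltr_nat.
rewrite -GU.
have Gcvg : (mu \o G) x @[x --> \oo] --> mu (\bigcup_k G k).
  have mG k : measurable (G k) by apply: measurable_itv.
  apply: nondecreasing_cvg_mu; [by []|exact: bigcupT_measurable|].
  move=> k l kl; apply/subsetPset => t; rewrite /G /= !in_itv /= => /le_trans; apply.
  by rewrite lerB // lef_pV2 ?posrE // ler_nat.
apply: (cvge_to_le Gcvg); apply: nearW => k.
apply/ltW; rewrite ltNge; apply/negP => pF.
have : A (inf A - k.+1%:R^-1) by [].
move=> /(ge_inf Alb); rewrite lerBrDr gerDl leNgt invr_gt0 ltr0n.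
by [].
Unshelve. all: by end_near. Qed.

End quantiles.

(** * Masses of intervals and points of [K] in slots *)

Section masses.
Local Open Scope classical_set_scope.
Variables (R : realType) (mu : probability (measurableTypeR R) R).

Lemma mass_between (z w p q : R) : (mu `]-oo, z[ <= p%:E)%E -> (q%:E <= mu `]-oo, w])%E ->
  ((q - p)%:E <= mu `[z, w])%E.
Proof.
move=> hp hq.
have h : (q%:E <= p%:E + mu `[z, w])%E.
  apply: (le_trans hq); apply: (@le_trans _ _ (mu (`]-oo, z[ `|` `[z, w]))).
    apply: le_measure; rewrite ?inE //; first exact: measurableU.
    move=> t /=; rewrite !in_itv /= => tw.
    by case: (ltP t z) => tz; [left|right; rewrite ?tz].
  apply: (le_trans (measureU2 mu _ _)) => //.
  by rewrite leeD2r.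
by rewrite EFinB leeBlDl.
Qed.

Lemma quantile_lt (z w p q : R) : p < q -> (mu `]-oo, z[ <= p%:E)%E ->
  (q%:E <= mu `]-oo, w])%E -> z <= w.
Proof.
move=> pq hp hq; rewrite leNgt; apply/negP => wz.
have : (q%:E <= p%:E)%E.
  apply: (le_trans hq); apply: le_trans hp.
  apply: le_measure; rewrite ?inE // => t /=; rewrite !in_itv /= => tw.
  exact: le_lt_trans wz.
by rewrite lee_fin leNgt pq.
Qed.

Variable K : set R.
Hypotheses (cK : closed K) (muK : mu (~` K) = 0%E).

Lemma mass_meets (A : set R) : measurable A -> (0 < mu A)%E -> exists2 t, K t & A t.
Proof.
move=> mA A0; apply: contrapT => H.
suff : (mu A <= 0)%E by rewrite leNgt A0.
rewrite -muK; apply: le_measure; rewrite ?inE //.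
  by apply: measurableC; apply: closed_measurable.
by move=> t At Kt; apply: H; exists t.
Qed.

Lemma mass_inter (A : set R) : measurable A -> (mu A <= mu (K `&` A))%E.
Proof.
move=> mA; have mK : measurable K by apply: closed_measurable.
apply: (@le_trans _ _ (mu ((K `&` A) `|` ~` K))).
  apply: le_measure; rewrite ?inE //.
    by apply: measurableU; [apply: measurableI|apply: measurableC].
  by move=> t At; have [Kt|Kt] := pselect (K t); [left|right].
apply: (le_trans (measureU2 mu _ _)); first exact: measurableI.
  exact: measurableC.
by rewrite [X in (_ + X)%E]muK adde0.
Qed.

(** Both closed half-lines at [z] carry positive mass, so [K] has points on both sides of [z]. *)
Lemma quantile_in (I : set R) (z p q : R) : is_interval I -> K `<=` I ->
  0 < p -> q < 1 -> (p%:E <= mu `]-oo, z])%E -> (mu `]-oo, z[ <= q%:E)%E -> I z.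
Proof.
move=> iI KI p0 q1 hp hq.
have [||s Ks] := @mass_meets `]-oo, z]; first exact: measurable_itv.
  by apply: lt_le_trans hp.
rewrite /= in_itv /= => sz.
have [||t Kt] := @mass_meets `[z, +oo[; first exact: measurable_itv.
  rewrite ltNge; apply/negP => z0.
  have : (1 <= q%:E)%E.
    rewrite -(probability_setT mu); apply: (@le_trans _ _ (mu (`]-oo, z[ `|` `[z, +oo[))).
      apply: le_measure; rewrite ?inE //; first exact: measurableU.
      move=> t _ /=; rewrite !in_itv /=.
      by case: (ltP t z) => tz; [left|right; rewrite ?tz].
    apply: (le_trans (measureU2 mu _ _)) => //.
    by rewrite -[X in (_ <= X)%E]adde0; apply: leeD.
  by rewrite lee_fin leNgt q1.
rewrite /= in_itv /= andbT => zt.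
by apply: (iI s t) => //; [exact: KI|exact: KI|rewrite sz].
Qed.

(** Take [y] minimising [|f|] on the compact part of [K] in [[z, w]], which carries mass at least
    [d]. *)
Lemma slot_point (I : set R) (f : R -> R) (z w d : R) : open I -> is_interval I ->
  K `<=` I -> I z -> I w -> {in I, continuous f} -> 0 < d -> (d%:E <= mu `[z, w])%E ->
  exists y, [/\ K y, z <= y, y <= w &
    ((d * `|f y|)%:E <= \int[mu]_(t in I) (`|f t|)%:E)%E].
Proof.
move=> oI iI KI Iz Iw cf d0 dmu.
pose A := K `&` `[z, w].
have mA : measurable A by apply: measurableI => //; apply: closed_measurable.
have dA : (d%:E <= mu A)%E by apply: (le_trans dmu); apply: mass_inter.
have A0 : (0 < mu A)%E by apply: lt_le_trans dA.
have [a Ka Aa] := mass_meets mA A0.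
have AI : A `<=` I by move=> t [/KI].
have cabs : {in I, continuous (fun t => `|f t|)}.
  move=> t It; apply: (@continuous_comp _ _ _ f (fun u => `|u|)); first exact: cf.
  exact: norm_continuous.
have [|||y yA ymin] := @compact_EVT_min R R (fun t => `|f t|) A.
- by exists a.
- by rewrite /A setIC; apply: compact_closedI => //; apply: segment_compact.
- apply: (@continuous_subspaceW _ _ _ I) => //.
  by rewrite continuous_open_subspace.
have Ay : A y by rewrite inE in yA.
have [Ky] := Ay; rewrite /= in_itv /= => /andP[zy yw].
exists y; split => //.
have mI : measurable I by apply: open_measurable.
have mf : measurable_fun (I : set (measurableTypeR R)) (fun t => (`|f t|)%:E).
  by apply/measurable_EFinP; apply: open_continuous_measurable_fun.
have h1 : (\int[mu]_(t in A) (`|f t|)%:E <= \int[mu]_(t in I) (`|f t|)%:E)%E.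
  by apply: ge0_subset_integral.
apply: le_trans h1.
have h2 : ((d * `|f y|)%:E <= \int[mu]_(t in A) (cst (`|f y|)%:E t))%E.
  by rewrite integral_cst // mulrC EFinM lee_wpmul2l // lee_fin.
apply: (le_trans h2); apply: ge0_le_integral => //=.
- exact: measurable_funS mf.
- by move=> t At; rewrite lee_fin; apply: ymin; rewrite inE.
Qed.

End masses.

Lemma quantile_sequence (R : realType) (mu : probability (measurableTypeR R) R)
    (I K : set R) (S : nat) :
  is_interval I -> closed K -> K `<=` I -> mu (~` K) = 0%E ->
  exists z : nat -> R, [/\ forall i j, (i <= j)%N -> z i <= z j,
    forall i, I (z i) &
    forall i j, (i <= j)%N -> (j <= S)%N ->
      (((j - i)%:R / S.+2%:R)%:E <= mu `[z i, z j]%classic)%E].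
Proof.
move=> iI cK KI muK.
(* The levels run from [1 / (S + 2)] to [(S + 1) / (S + 2)], avoiding [0] and [1]; capping the index
   at [S] keeps the sequence monotone on all of [nat]. *)
pose lvl (i : nat) : R := (minn i S).+1%:R / S.+2%:R.
have S0 : 0 < S.+2%:R :> R by rewrite ltr0n.
have lvl0 i : 0 < lvl i by rewrite divr_gt0 ?ltr0n.
have lvl1 i : lvl i < 1.
  by rewrite ltr_pdivrMr // mul1r ltr_nat !ltnS geq_minr.
have [Z ZP] := choice (fun i => quantile_exists mu (lvl0 i) (lvl1 i)).
exists (fun i => Z (minn i S)); split.
- move=> i j ij; have := geq_minr i S; have := geq_minr j S.
  have : (minn i S <= minn j S)%N by rewrite leq_min geq_minr (leq_trans (geq_minl i S) ij).
  move: (minn i S) (minn j S) => {ij}i {}j; rewrite leq_eqVlt => /predU1P[->//|ij] jS iS.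
  have [_ hi] := ZP i; have [hj _] := ZP j.
  apply: (quantile_lt _ hi hj); rewrite /lvl !(minn_idPl _) //.
  by rewrite ltr_pM2r ?invr_gt0 // ltr_nat.
- move=> i; have [hi hi'] := ZP (minn i S).
  exact: (quantile_in cK muK iI KI (lvl0 _) (lvl1 _) hi hi').
- move=> i j ij jS; have iS := leq_trans ij jS.
  rewrite !(minn_idPl _) //.
  have [_ hi] := ZP i; have [hj _] := ZP j.
  have := mass_between hi hj; congr (_%:E <= _)%E.
  rewrite /lvl !(minn_idPl _) // -mulrBl; congr (_ / _).
  by rewrite natrB // -!natr1; ring.
Qed.

(** * Polynomial type in real terms and the final assembly *)

Lemma derivs_Cn (R : realType) (I : set R) (n : nat) (f : R -> R) :
  Cn_on n I f -> derivs I n (fun k => derive1n k f).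
Proof.
move=> [fD _] k kn t It; rewrite derive1nS derive1E.
exact/derivableP/fD.
Qed.

Lemma polynomial_type_bounds (R : realType) (n : nat) (S I : set R) (C : R) (f : R -> R) :
  S !=set0 -> S `<=` I -> polynomial_type n S I C f ->
  exists m, [/\ 0 <= m, forall t, S t -> m <= `|derive1n n f t| &
    forall t, I t -> `|derive1n n f t| <= C * m].
Proof.
move=> [s Ss] SI [_ _ hC].
set E := ereal_inf _ in hC.
have E0 : (0 <= E)%E by apply: le_ereal_inf_tmp => _ [t _ <-]; rewrite lee_fin.
have Es : (E <= (`|derive1n n f s|)%:E)%E by apply: ereal_inf_lbound; exists s.
have Ef : E \is a fin_num by rewrite ge0_fin_numE // (le_lt_trans Es) // ltry.
exists (fine E); split; first exact: fine_ge0.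
  by move=> t St; rewrite -lee_fin fineK //; apply: ereal_inf_lbound; exists t.
move=> t It; rewrite -lee_fin EFinM fineK //; apply: le_trans hC.
by apply: ereal_sup_ubound; exists t.
Qed.

(** Dividing by [k] bounds the supremum. For [k = 0] it may be infinite, and the convention
    [0 * +oo = 0] settles the case. *)
Lemma scaled_sup_le (R : realType) (k L : R) (g : R -> R) (A : set R) (q X : \bar R) :
  A !=set0 -> (forall t, A t -> 0 <= g t) -> 0 <= k -> 0 <= L -> (q <= k%:E)%E ->
  (forall t, A t -> k * g t <= L) -> (L%:E <= X)%E ->
  (q * ereal_sup [set (g t)%:E | t in A] <= X)%E.
Proof.
move=> [a Aa] g0 k0 L0 qk kg LX.
have s0 : (0 <= ereal_sup [set (g t)%:E | t in A])%E.
  by apply: le_ereal_sup_tmp; exists (g a)%:E; [exists a|rewrite lee_fin g0].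
apply: (le_trans (lee_wpmul2r s0 qk)); apply: le_trans LX.
move: k0; rewrite le_eqVlt => /predU1P[<-|k0]; first by rewrite mul0e.
have : (ereal_sup [set (g t)%:E | t in A] <= (L / k)%:E)%E.
  apply: ge_ereal_sup => _ [t At <-].
  by rewrite lee_fin ler_pdivlMr // mulrC kg.
have k0' : (0 <= k%:E)%E by rewrite lee_fin ltW.
move=> /(lee_wpmul2l k0') /le_trans; apply.
by rewrite -EFinM lee_fin mulrC divfK // gt_eqF.
Qed.

Theorem corollary1 (R : realType) (n : nat) (eps : R)
  (hn : (0 < n)%N) (heps0 : 0 < eps) (heps1 : eps < 1) :
  exists2 c : R, 0 < c &
    forall (I K : set R) (mu : probability (measurableTypeR R) R),
      open I -> is_interval I -> closed K -> K `<=` I ->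
      regular_measure mu -> mu (~` K) = 0%E ->
      exists a b : R,
        [/\ a <= b,
            `[a, b]%classic `<=` I,
            (((1 - eps) / n%:R)%:E <= mu `[a, b]%classic)%E
          & forall (C : R) (f : R -> R), 1 <= C ->
              polynomial_type n (K_eps I K eps) I C f ->
              forall j : nat, (j <= n)%N ->
                ((c * C^-1)%:E
                   * mine ((b - a)%:E ^+ j) (measure_length mu n eps ^+ j)
                   * ereal_sup [set (`|derive1n j f t|)%:E | t in `[a, b]%classic]
                 <= \int[mu]_(t in I) (`|f t|)%:E)%E].
Proof.
(* Since [slots n r + 2 = n r + (n^2 + n + 3)], having [n^2 + n + 3 <= eps * r] makes [r] slots of
   mass [1 / (slots n r + 2)] weigh at least [(1 - eps) / n]. *)
pose Q : R := (n * n + n + 3)%:R / eps.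
have [r [nr r0 theta]] : exists r, [/\ (n * n + n <= r)%N, (0 < r)%N &
    (1 - eps) / n%:R <= r%:R / (slots n r).+2%:R].
  exists (n * n + n + Num.bound Q)%N; set r := (n * n + n + _)%N.
  split; [exact: leq_addr|by rewrite !addn_gt0 hn orbT|].
  have n0 : 0 < n%:R :> R by rewrite ltr0n.
  have Qr : (n * n + n + 3)%:R <= r%:R * eps.
    have Q0 : 0 <= Q by rewrite divr_ge0 // ltW.
    have := archi_boundP Q0; rewrite ltr_pdivrMr // => /ltW /le_trans; apply.
    by rewrite ler_wpM2r ?(ltW heps0) // ler_nat leq_addl.
  rewrite ler_pdivrMr // mulrAC ler_pdivlMr ?ltr0n //.
  have -> : (slots n r).+2 = (n * r + (n * n + n + 3))%N.
    by rewrite /slots mulnS; lia.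
  rewrite natrD natrM.
  have n1 : 1 <= n%:R :> R by rewrite ler1n.
  have re0 : 0 <= r%:R * eps by rewrite mulr_ge0 // ltW.
  have : r%:R * eps <= n%:R * (r%:R * eps) by rewrite ler_peMl.
  have : 0 <= eps * (n * n + n + 3)%:R by rewrite mulr_ge0 // ltW.
  move: Qr; set q : R := (n * n + n + 3)%:R; lra.
set S := slots n r in theta.
pose d : R := S.+2%:R^-1.
have d0 : 0 < d by rewrite invr_gt0 ltr0n.
have B0 : 0 < (2 ^+ n)^-1 :> R by rewrite invr_gt0 exprn_gt0.
have [c0 c0_gt0 bound] := derivative_bound hn heps0 heps1 B0.
(* Each slot has mass at least [d]; the [+ 1] covers the case where [I'] is a single point. *)
exists (d / (c0 + 1)).
  by rewrite divr_gt0 // addr_gt0.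
move=> I K mu oI iI cK KI _ muK.
have [z [z_nd zI zmass]] := quantile_sequence S iI cK KI muK.
have [al [idx [beta [als idxS sel]]]] := selection z_nd hn nr.
have z_ab : z al <= z (al + r)%N by rewrite z_nd // leq_addr.
have abI : `[z al, z (al + r)%N] `<=` I by apply: subset_itv_interval.
have mab : ((r%:R * d)%:E <= mu `[z al, z (al + r)%N]%classic)%E.
  by have := zmass al (al + r)%N (leq_addr _ _) als; rewrite addnC addnK.
exists (z al), (z (al + r)%N); split => //.
  by apply: le_trans mab; rewrite lee_fin.
move=> C f C1 fP j jn.
have C0 : 0 < C by apply: lt_le_trans C1.
have fD : derivs I n (fun k => derive1n k f) by apply: derivs_Cn; case: fP.
have fsign : (forall t, I t -> 0 <= derive1n n f t) \/ (forall t, I t -> derive1n n f t <= 0).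
  by case: fP.
have fc : {in I, continuous f}.
  move=> t; rewrite inE => It; apply/differentiable_continuous/derivable1_diffP.
  by have [] := fD 0%N hn t It.
have [k0 Kk0 _] : exists2 t, K t & [set: R] t.
  by apply: (mass_meets cK muK) => //; rewrite [X in (_ < X)%E]probability_setT lte_fin.
have [m [m0 mK mI]] : exists m, [/\ 0 <= m,
    forall t, K_eps I K eps t -> m <= `|derive1n n f t| &
    forall t, I t -> `|derive1n n f t| <= C * m].
  apply: (polynomial_type_bounds _ _ fP); first by exists k0; left; left.
  by move=> t [[/KI|[]]|[]].
have [->|Ifin] := eqVneq (\int[mu]_(t in I) (`|f t|)%:E)%E +oo%E; first by rewrite leey.
have I0 : (0 <= \int[mu]_(t in I) (`|f t|)%:E)%E by apply: integral_ge0.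
set L := fine (\int[mu]_(t in I) (`|f t|)%:E)%E.
have LE : (L%:E = \int[mu]_(t in I) (`|f t|)%:E)%E.
  by rewrite fineK // ge0_fin_numE // ltey.
have L0 : 0 <= L by apply: fine_ge0.
have slot u v : I u -> I v -> (d%:E <= mu `[u, v]%classic)%E ->
    exists y, [/\ K y, u <= y <= v & `|f y| <= L / d].
  move=> Iu Iv duv; have [y [Ky uy yv]] := slot_point cK muK oI iI KI Iu Iv fc d0 duv.
  rewrite -LE lee_fin => hy; exists y; split; rewrite ?uy //.
  by rewrite ler_pdivlMr // mulrC.
have cC0 : 0 <= d / (c0 + 1) * C^-1.
  by rewrite !mulr_ge0 ?invr_ge0 ?(ltW d0) ?(ltW C0) // addr_ge0 // ltW.
apply: (@scaled_sup_le _ (d / (c0 + 1) * C^-1 * (z (al + r)%N - z al) ^+ j) L) => //.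
- by exists (z al) => /=; rewrite in_itv /= lexx.
- by rewrite mulr_ge0 // exprn_ge0 // subr_ge0.
- by rewrite [X in (_ <= X)%E]EFinM lee_wpmul2l ?lee_fin // EFin_expe ge_min lexx.
- move=> t tab.
  suff key : `|derive1n j f t| * (z (al + r)%N - z al) ^+ j <= (c0 + 1) * C * (L / d).
    have := ler_wpM2l cC0 key.
    have -> : d / (c0 + 1) / C * ((c0 + 1) * C * (L / d)) = L.
      by field; rewrite !gt_eqF // addr_gt0.
    by rewrite [`|_| * _]mulrC mulrA.
  have L1 : 0 <= L / d by rewrite divr_ge0 // ltW.
  have CL : 0 <= C * (L / d) by rewrite mulr_ge0 // ltW.
  move: (z_ab); rewrite le_eqVlt => /predU1P[zeq|zlt].
    (* When [I'] is a point, [0^j] vanishes for [j > 0], and for [j = 0] that point is the [y] given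
       by [slot]. *)
    rewrite -zeq subrr; case: j jn => [_|j _]; last first.
      by rewrite expr0n mulr0 -mulrA mulr_ge0 // addr_ge0 // ltW.
    have [|y [_ yz fy]] := slot _ _ (zI al) (zI (al + r)%N).
      apply: le_trans mab; rewrite lee_fin ler_peMl ?(ltW d0) //.
      by rewrite ler1n.
    have ty : t = y.
      move: tab yz; rewrite /= in_itv /= -zeq -!eq_le.
      by move=> /eqP <- /eqP.
    rewrite expr0 mulr1 derive1n0 ty; apply: (le_trans fy).
    rewrite -mulrA mulrDl mul1r.
    have := ler_wpM2r L1 C1; rewrite mul1r => /le_trans; apply.
    by rewrite lerDr mulr_ge0 // ltW.
  (* One point of [K] in each selected slot, with [|f|] at most [L / d] there; indices above [n] get
     the default [0]. *)
  have [y yP] : exists y : nat -> R, forall k, (k <= n)%N ->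
      [/\ K (y k), z (idx k) <= y k <= z (idx k).+1 & `|f (y k)| <= L / d].
    have : forall k, exists y, (k <= n)%N ->
      [/\ K y, z (idx k) <= y <= z (idx k).+1 & `|f y| <= L / d].
      move=> k; have [kn|_] := leqP k n; last by exists 0.
      have [|y yP] := slot (z (idx k)) (z (idx k).+1) (zI _) (zI _).
        have := zmass (idx k) (idx k).+1 (leqnSn _) (idxS k kn).
        by rewrite subSnn mul1r.
      by exists y.
    by move=> /choice[y yP]; exists y.
  have [|b1 b2 b3 b4] := sel zlt y; first by move=> k /yP[].
  apply: (@le_trans _ _ (c0 * C * (L / d))); last first.
    rewrite -[X in X <= _]mulrA -[X in _ <= X]mulrA; apply: ler_wpM2r => //.
    by rewrite lerDl.
  apply: (bound I K (fun k => derive1n k f) m C (L / d) _ _ y beta) => //.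
  - by move=> k /yP[].
  - by move=> k /yP[_ _]; rewrite derive1n0.
- by rewrite LE.
Qed.
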